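(* The concept satisfiability problem for $\mathcal{ALCO}_{\mathsf{vpl}}$ is undecidable, even if the languages allowed in concepts are restricted to $\{r, s, r^+, s^+, r^*, s^*, (r+s)^*, (r+s)^+, r^{\#}s^{\#}\}$, where $r$ is a fixed call role name, $s$ is a fixed return role name, and $r^{\#}s^{\#}:=\{r^ns^n\mid n\in\mathbb{N}\}$.
   Context: Fix countably infinite pairwise disjoint sets of individual names, concept names and role names; role names are partitioned into call, internal and return role names, and test letters $A?$ ($A$ a concept name) count as internal. An interpretation $\mathcal{I}$ has a non-empty domain, maps individual names to elements, concept names to subsets and role names to binary relations. A path $\rho_1\dots\rho_{n+1}$ is an $\mathcal{L}$-path if some word $w_1\dots w_n\in\mathcal{L}$ satisfies for each $i$: $w_i$ is a role name with $(\rho_i,\rho_{i+1})\in w_i^{\mathcal{I}}$, or $w_i=A?$ with $\rho_i=\rho_{i+1}\in A^{\mathcal{I}}$. $\mathcal{ALC}_{\mathsf{vpl}}$ concepts are built from $\top$, concept names, $\neg$, $\sqcap$, $\exists r.C$ and $\exists\mathcal{L}.C$ with $\mathcal{L}$ a visibly-pushdown language (given by a nondeterministic visibly-pushdown automaton) over finitely many of these letters; $(\exists\mathcal{L}.C)^{\mathcal{I}}$ consists of elements having an $\mathcal{L}$-path ending in $C^{\mathcal{I}}$. $\mathcal{ALCO}_{\mathsf{vpl}}$ additionally allows nominals $\{a\}$ for individual names $a$, with $\{a\}^{\mathcal{I}}=\{a^{\mathcal{I}}\}$. Concept satisfiability: given $C$, is there $\mathcal{I}$ with $C^{\mathcal{I}}\neq\emptyset$?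 *)

(* Defs.v *)
From Stdlib Require Import List Arith.
Import ListNotations.

Inductive role : Type :=
| CallRole : nat -> role
| IntRole  : nat -> role
| RetRole  : nat -> role.

Definition r_role : role := CallRole 0.
Definition s_role : role := RetRole 0.

(* Letters of words: role names and test letters A? (A a concept name). *)
Inductive letter : Type :=
| LRole : role -> letter
| LTest : nat -> letter.

Inductive lang : Type :=
| L_r | L_s | L_rplus | L_splus | L_rstar | L_sstar
| L_rs_star | L_rs_plus | L_rnsn.

Definition is_rs (x : letter) : Prop := x = LRole r_role \/ x = LRole s_role.

Definition lang_words (L : lang) (w : list letter) : Prop :=
  match L with
  | L_r => w = [LRole r_role]
  | L_s => w = [LRole s_role]
  | L_rplus => exists n, 1 <= n /\ w = repeat (LRole r_role) n
  | L_splus => exists n, 1 <= n /\ w = repeat (LRole s_role) n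
  | L_rstar => exists n, w = repeat (LRole r_role) n
  | L_sstar => exists n, w = repeat (LRole s_role) n
  | L_rs_star => Forall is_rs w
  | L_rs_plus => w <> [] /\ Forall is_rs w
  | L_rnsn => exists n, w = repeat (LRole r_role) n ++ repeat (LRole s_role) n
  end.

Inductive concept : Type :=
| CTop : concept
| CName : nat -> concept
| CNom : nat -> concept
| CNeg : concept -> concept
| CAnd : concept -> concept -> concept
| CExR : role -> concept -> concept
| CExL : lang -> concept -> concept.

Record interp (D : Type) : Type := {
  i_ind : nat -> D;
  i_cn : nat -> D -> Prop;
  i_rn : role -> D -> D -> Prop }.
Arguments i_ind {D} _ _.
Arguments i_cn {D} _ _ _.
Arguments i_rn {D} _ _ _ _.

Fixpoint word_path {D : Type} (I : interp D) (w : list letter) (x y : D) : Prop :=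
  match w with
  | [] => x = y
  | LRole q :: w' => exists z, i_rn I q x z /\ word_path I w' z y
  | LTest A :: w' => i_cn I A x /\ word_path I w' x y
  end.

Fixpoint csem {D : Type} (I : interp D) (C : concept) (d : D) : Prop :=
  match C with
  | CTop => True
  | CName A => i_cn I A d
  | CNom a => d = i_ind I a
  | CNeg C' => ~ csem I C' d
  | CAnd C1 C2 => csem I C1 d /\ csem I C2 d
  | CExR q C' => exists e, i_rn I q d e /\ csem I C' e
  | CExL L C' => exists w e, lang_words L w /\ word_path I w d e /\ csem I C' e
  end.

(* C is satisfiable: some interpretation (with non-empty domain, witnessed
   by d) has C^I non-empty. *)
Definition satisfiable (C : concept) : Prop :=
  exists (D : Type) (I : interp D) (d : D), csem I C d.

Definition cpair (x y : nat) : nat := (x + y) * (x + y + 1) / 2 + y.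

Definition enc_role (q : role) : nat :=
  match q with
  | CallRole n => 3 * n
  | IntRole n => 3 * n + 1
  | RetRole n => 3 * n + 2
  end.

Definition enc_lang (L : lang) : nat :=
  match L with
  | L_r => 0 | L_s => 1 | L_rplus => 2 | L_splus => 3 | L_rstar => 4
  | L_sstar => 5 | L_rs_star => 6 | L_rs_plus => 7 | L_rnsn => 8
  end.

Fixpoint enc_concept (C : concept) : nat :=
  match C with
  | CTop => cpair 0 0
  | CName A => cpair 1 A
  | CNom a => cpair 2 a
  | CNeg C' => cpair 3 (enc_concept C')
  | CAnd C1 C2 => cpair 4 (cpair (enc_concept C1) (enc_concept C2))
  | CExR q C' => cpair 5 (cpair (enc_role q) (enc_concept C'))
  | CExL L C' => cpair 6 (cpair (enc_lang L) (enc_concept C'))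
  end.

Definition SAT_set (n : nat) : Prop :=
  exists C, enc_concept C = n /\ satisfiable C.

Inductive rf : Type :=
| RZero : rf
| RSucc : rf
| RProj : nat -> rf
| RComp : rf -> list rf -> rf
| RPrim : rf -> rf -> rf
| RMu : rf -> rf.

Inductive eval : rf -> list nat -> nat -> Prop :=
| ev_zero : forall v, eval RZero v 0
| ev_succ : forall x v, eval RSucc (x :: v) (S x)
| ev_proj : forall i v, eval (RProj i) v (nth i v 0)
| ev_comp : forall f gs v ys y,
    Forall2 (fun g z => eval g v z) gs ys -> eval f ys y -> eval (RComp f gs) v y
| ev_prim0 : forall f g v y, eval f v y -> eval (RPrim f g) (0 :: v) y
| ev_primS : forall f g n v z y,
    eval (RPrim f g) (n :: v) z -> eval g (n :: z :: v) y ->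
    eval (RPrim f g) (S n :: v) y
| ev_mu : forall f v n,
    eval f (n :: v) 0 ->
    (forall m, m < n -> exists k, eval f (m :: v) (S k)) ->
    eval (RMu f) v n.

Definition rf_decides (c : rf) (P : nat -> Prop) : Prop :=
  forall n, (P n -> eval c [n] 1) /\ (~ P n -> eval c [n] 0).

Definition rf_decidable (P : nat -> Prop) : Prop := exists c, rf_decides c P.

(* Main.v *)
(* The models are made to carry computation tables of register machines.  From a nominal a
   hangs an s-chain A 0, A 1, ... of cells and from a second nominal b an s-chain B 0, B 1, ...
   A node at r-distance k from a nominal sees, through r#s#, exactly the k-th node of its
   s-chain.  A line of nodes that is at equal r-distance from a and b forces the two chains to
   agree; a line that is N steps further from b than from a compares A j with B (j + N).
   Together they relate cells j and j + N, i.e. vertically adjacent cells of a table with rows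
   of width N, where N is chosen by the model; horizontal constraints use s.  Hence for each
   machine there is a concept whose conjunction with (exists s)^(n+1).Input is satisfiable iff
   the machine accepts n.  Since n only enters through this conjunct, undecidability follows by
   running the machine that negates a supposed decider on the code of its own concept, without
   a universal machine. *)
From Stdlib Require Import List Arith Lia Classical.
Import ListNotations.
Require Import Defs.

(** * Register machines *)

(** There are two chains because a rule must be oriented: a node that sees cells [j] and [j + N] of
    one chain could not tell which comes first. The concept names 0 and 1 mark the chains, so a rule
    reads its premise on one and imposes its conclusion on the other. Copying is one-sided: premises
    of vertical rules travel from the second chain to the first, and only three facts, about input
    and acceptance, are brought the other way. Nothing makes a chain or a line unique. The
    constraints are therefore universal over all cells at a given distance, so that any choice of
    one path through each chain yields a table. Finiteness comes from acceptance: a cell that is not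
    accepting has an s-successor, and the far end of each line requires the cells it sees to be
    accepting, so a chain is never followed beyond its line. Numbers are unary, a register value
    being the offset of a marked cell in its row. One machine step then only compares neighbouring
    cells, and the model may choose [N] large enough for any given accepting run. *)

Inductive op : Type := Zero | Copy (i : nat) | Succ (i : nat) | Pred (i : nat).

Inductive instr : Type :=
| Asg : nat -> op -> instr
| Jz : nat -> nat -> instr.

Definition config : Type := (nat * (nat -> nat))%type.

Definition opval (o : op) (rho : nat -> nat) : nat :=
  match o with
  | Zero => 0
  | Copy i => rho i
  | Succ i => S (rho i)
  | Pred i => pred (rho i)
  end.

Definition upd (rho : nat -> nat) (j x : nat) : nat -> nat :=
  fun i => if i =? j then x else rho i.

Definition step (P : list instr) (c : config) : config :=
  match nth_error P (fst c) with
  | Some (Asg j o) => (S (fst c), upd (snd c) j (opval o (snd c)))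
  | Some (Jz i l) => (if snd c i =? 0 then l else S (fst c), snd c)
  | None => c
  end.

Definition run (P : list instr) (t : nat) (c : config) : config :=
  Nat.iter t (step P) c.

Definition reach (P : list instr) (c c' : config) : Prop := exists t, run P t c = c'.

Lemma run_add P t u c : run P (t + u) c = run P t (run P u c).
Proof. unfold run. now rewrite Nat.iter_add. Qed.

Lemma reach_refl P c : reach P c c.
Proof. now exists 0. Qed.

Lemma reach_trans P c1 c2 c3 : reach P c1 c2 -> reach P c2 c3 -> reach P c1 c3.
Proof.
  intros [t Ht] [u Hu]. exists (u + t). now rewrite run_add, Ht.
Qed.

Lemma reach_step P c c' : step P c = c' -> reach P c c'.
Proof. intros H. exists 1. exact H. Qed.

Definition code_at (P : list instr) (p : nat) (cs : list instr) : Prop :=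
  forall i, i < length cs -> nth_error P (p + i) = nth_error cs i.

Lemma code_at_app P p c1 c2 :
  code_at P p (c1 ++ c2) -> code_at P p c1 /\ code_at P (p + length c1) c2.
Proof.
  intros H; split; intros i Hi.
  - rewrite H by (rewrite length_app; lia). now rewrite nth_error_app1.
  - rewrite <- Nat.add_assoc, H by (rewrite length_app; lia).
    rewrite nth_error_app2 by lia. f_equal; lia.
Qed.

Lemma code_at_cons P p x cs :
  code_at P p (x :: cs) -> nth_error P p = Some x /\ code_at P (S p) cs.
Proof.
  intros H; split.
  - specialize (H 0). rewrite Nat.add_0_r in H. apply H. simpl; lia.
  - intros i Hi. specialize (H (S i)). rewrite Nat.add_succ_r in H. apply H. simpl; lia.
Qed.

Lemma reach_asg P p j o rho : nth_error P p = Some (Asg j o) ->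
  reach P (p, rho) (S p, upd rho j (opval o rho)).
Proof. intros H. apply reach_step. unfold step; simpl. now rewrite H. Qed.

Lemma reach_jz P p i l rho : nth_error P p = Some (Jz i l) ->
  reach P (p, rho) (if rho i =? 0 then l else S p, rho).
Proof. intros H. apply reach_step. unfold step; simpl. now rewrite H. Qed.

Lemma upd_same rho j x : upd rho j x j = x.
Proof. unfold upd. now rewrite Nat.eqb_refl. Qed.

Lemma upd_other rho j x i : i <> j -> upd rho j x i = rho i.
Proof. intros H. unfold upd. apply Nat.eqb_neq in H. now rewrite H. Qed.

(* [comp f xs b p]: code placed at address [p] that computes [f] from the
   registers [xs] (all below [b]) into register [b]; registers above [b] are scratch. *)
Fixpoint comp (f : rf) (xs : list nat) (b p : nat) {struct f} : list instr :=
  match f with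
  | RZero => [Asg b Zero]
  | RSucc => match xs with x :: _ => [Asg b (Succ x)] | [] => [] end
  | RProj i => match nth_error xs i with Some x => [Asg b (Copy x)] | None => [Asg b Zero] end
  | RComp f gs =>
      let cs := (fix go gs k p := match gs with
                 | [] => []
                 | g :: gs' => let c := comp g xs k p in c ++ go gs' (S k) (p + length c)
                 end) gs b p in
      let n := length gs in
      cs ++ comp f (seq b n) (b + n) (p + length cs) ++ [Asg b (Copy (b + n))]
  | RPrim f g =>
      match xs with
      | [] => []
      | x :: xs' =>
          let c1 := comp f xs' b p in
          let l := p + length c1 + 2 in
          let c2 := comp g (S b :: b :: xs') (3 + b) (S l) in
          c1 ++ [Asg (S b) Zero; Asg (2 + b) (Copy x)] ++
          [Jz (2 + b) (S l + length c2 + 5)] ++ c2 ++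
          [Asg b (Copy (3 + b)); Asg (S b) (Succ (S b)); Asg (2 + b) (Pred (2 + b));
           Asg (3 + b) Zero; Jz (3 + b) l]
      end
  | RMu f =>
      let c := comp f (b :: xs) (S b) (S p) in
      [Asg b Zero] ++ c ++
      [Jz (S b) (S p + length c + 4); Asg b (Succ b); Asg (S b) Zero; Jz (S b) (S p)]
  end.

(** The local fixpoint [go] of [comp] under a name, so that induction on the list is possible. *)
Fixpoint comps (gs : list rf) (xs : list nat) (k p : nat) : list instr :=
  match gs with
  | [] => []
  | g :: gs' => let c := comp g xs k p in c ++ comps gs' xs (S k) (p + length c)
  end.

Lemma comp_RComp f gs xs b p : comp (RComp f gs) xs b p =
  comps gs xs b p ++
  comp f (seq b (length gs)) (b + length gs) (p + length (comps gs xs b p)) ++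
  [Asg b (Copy (b + length gs))].
Proof.
  simpl. set (go := fix go gs k p := match gs with
                 | [] => []
                 | g :: gs' => let c := comp g xs k p in c ++ go gs' (S k) (p + length c)
                 end).
  assert (E : forall gs k p, go gs k p = comps gs xs k p).
  { clear. intros gs. induction gs as [|g gs IH]; intros k p; simpl; [reflexivity|].
    now rewrite IH. }
  now rewrite !E.
Qed.

(** * Correctness of the compiled code *)

Lemma rf_ind_nested (Q : rf -> Prop) :
  Q RZero -> Q RSucc -> (forall i, Q (RProj i)) ->
  (forall f gs, Q f -> Forall Q gs -> Q (RComp f gs)) ->
  (forall f g, Q f -> Q g -> Q (RPrim f g)) ->
  (forall f, Q f -> Q (RMu f)) ->
  forall f, Q f.
Proof.
  intros H0 HS HP HC HR HM. fix IH 1. intros f; destruct f as [| |i|f gs|f g|f].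
  - exact H0.
  - exact HS.
  - apply HP.
  - apply HC; [apply IH|]. induction gs as [|g gs IHgs]; constructor; [apply IH|exact IHgs].
  - apply HR; apply IH.
  - apply HM; apply IH.
Qed.

(** The ambient program [P] is fixed, so fragments compose by [reach_trans]. Nothing is assumed
    about registers from [b] on, so a loop may re-enter its body with used scratch registers. *)
Definition simulates (P : list instr) (f : rf) : Prop :=
  forall xs b p y rho, code_at P p (comp f xs b p) -> Forall (fun x => x < b) xs ->
  eval f (map rho xs) y ->
  exists rho', reach P (p, rho) (p + length (comp f xs b p), rho') /\
    rho' b = y /\ forall r, r < b -> rho' r = rho r.

Lemma map_ext_below (rho rho' : nat -> nat) b xs : Forall (fun x => x < b) xs ->
  (forall r, r < b -> rho' r = rho r) -> map rho' xs = map rho xs.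
Proof.
  intros Hx H. apply map_ext_in. intros a Ha. apply H.
  rewrite Forall_forall in Hx. auto.
Qed.

Lemma Forall_lt_weaken (b b' : nat) xs : b <= b' ->
  Forall (fun x => x < b) xs -> Forall (fun x => x < b') xs.
Proof. intros H. apply Forall_impl. intros; lia. Qed.

Lemma simulates_list P gs : Forall (simulates P) gs ->
  forall xs b k p ys rho, code_at P p (comps gs xs k p) -> Forall (fun x => x < b) xs ->
  b <= k -> Forall2 (fun g z => eval g (map rho xs) z) gs ys ->
  exists rho', reach P (p, rho) (p + length (comps gs xs k p), rho') /\
    map rho' (seq k (length gs)) = ys /\ forall r, r < k -> rho' r = rho r.
Proof.
  induction 1 as [|g gs Hg Hgs IH]; intros xs b k p ys rho Hc Hx Hk Hev; inversion Hev; subst.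
  - exists rho. simpl. rewrite Nat.add_0_r. auto using reach_refl.
  - simpl in Hc. apply code_at_app in Hc as [Hc1 Hc2].
    destruct (Hg xs k p y rho) as (rho1 & Hr1 & Hy1 & Hp1); auto.
    { eapply Forall_lt_weaken; eauto. }
    destruct (IH xs b (S k) _ l' rho1 Hc2) as (rho2 & Hr2 & Hy2 & Hp2); auto.
    { rewrite (map_ext_below rho rho1 b); auto. intros; apply Hp1; lia. }
    exists rho2; repeat split.
    + simpl. rewrite length_app, Nat.add_assoc. eapply reach_trans; eauto.
    + simpl. f_equal; auto. rewrite Hp2 by lia. auto.
    + intros r Hr. rewrite Hp2 by lia. apply Hp1; lia.
Qed.

(** A derivation unwinds the recursion from [n] downwards, while the compiled loop counts upwards;
    [w] lists the intermediate values in the order of the loop. *)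
Lemma eval_prim_trace f g v n y : eval (RPrim f g) (n :: v) y ->
  exists w : nat -> nat, eval f v (w 0) /\ w n = y /\
    forall i, i < n -> eval g (i :: w i :: v) (w (S i)).
Proof.
  revert y. induction n as [|n IH]; intros y H;
    inversion H as [| | | |? ? ? ? H0|? ? ? ? z ? Hz Hg|]; subst.
  - exists (fun _ => y). repeat split; auto. intros; lia.
  - destruct (IH _ Hz) as (w & H0 & Hn & Hs).
    exists (fun i => if i =? S n then y else w i). simpl. rewrite Nat.eqb_refl.
    repeat split; auto. intros i Hi.
    replace (i =? S n) with false by (symmetry; apply Nat.eqb_neq; lia).
    destruct (Nat.eqb_spec i n) as [->|Hin]; [rewrite Hn; assumption|].
    apply Hs. lia.
Qed.

(** In the compiled loop [b] is the accumulator, [S b] the ascending index, [2 + b] the number of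
    rounds left and [3 + b] the result of [g]. Clearing [3 + b] just before testing it makes the
    last [Jz] an unconditional jump. The induction is on the rounds left. *)
Lemma simulates_prim P f g : simulates P f -> simulates P g -> simulates P (RPrim f g).
Proof.
  intros Hf Hg xs b p y rho Hc Hx Hev. destruct xs as [|x xs]; [inversion Hev|].
  inversion Hx as [|? ? Hxb Hx']; subst.
  destruct (eval_prim_trace _ _ _ _ _ Hev) as (w & Hw0 & Hwn & Hws). clear Hev.
  simpl in Hc |- *.
  set (c1 := comp f xs b p) in *. set (l := p + length c1 + 2) in *.
  set (c2 := comp g (S b :: b :: xs) (S (S (S b))) (S l)) in *.
  apply code_at_app in Hc as [Hc1 Hc].
  apply code_at_cons in Hc as [I1 Hc]. apply code_at_cons in Hc as [I2 Hc].
  apply code_at_cons in Hc as [I3 Hc]. apply code_at_app in Hc as [Hc2 Hc].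
  replace (S (S (p + length c1))) with l in I3, Hc2, Hc by (unfold l; lia).
  apply code_at_cons in Hc as [I4 Hc]. apply code_at_cons in Hc as [I5 Hc].
  apply code_at_cons in Hc as [I6 Hc]. apply code_at_cons in Hc as [I7 Hc].
  apply code_at_cons in Hc as [I8 _].
  destruct (Hf xs b p _ rho Hc1 Hx' Hw0) as (rho1 & Hr1 & Hy1 & Hp1).
  fold c1 in Hr1.
  assert (Hloop : forall m i rho0, i + m = rho x ->
     (forall r, r < b -> rho0 r = rho r) -> rho0 (S b) = i -> rho0 (S (S b)) = m ->
     rho0 b = w i ->
     exists rho', reach P (l, rho0) (S (l + length c2 + 5), rho') /\
       rho' b = w (rho x) /\ forall r, r < b -> rho' r = rho r).
  { induction m as [|m IHm]; intros i rho0 Hi Hp0 Hib Hmb Hacc.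
    - exists rho0. split; [|split; [|exact Hp0]].
      + eapply reach_trans; [apply reach_jz, I3|]. rewrite Hmb. apply reach_refl.
      + rewrite Hacc. f_equal. lia.
    - assert (Hxs0 : map rho0 xs = map rho xs) by (eapply map_ext_below; eauto).
      destruct (Hg (S b :: b :: xs) (S (S (S b))) (S l) (w (S i)) rho0 Hc2)
        as (rho2 & Hr2 & Hy2 & Hp2).
      { repeat constructor; try lia. eapply Forall_lt_weaken; [|exact Hx']. lia. }
      { simpl. rewrite Hib, Hxs0, Hacc. apply Hws. lia. }
      fold c2 in Hr2.
      edestruct (IHm (S i)) as (rho3 & Hr3 & Hy3 & Hp3); [lia| | | | |].
      5:{ exists rho3. split; [|split; [exact Hy3|exact Hp3]].
          eapply reach_trans; [apply reach_jz, I3|]. rewrite Hmb. simpl (_ =? _). cbv iota.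
          eapply reach_trans; [exact Hr2|].
          eapply reach_trans; [apply reach_asg, I4|].
          eapply reach_trans; [apply reach_asg, I5|].
          eapply reach_trans; [apply reach_asg, I6|].
          eapply reach_trans; [apply reach_asg, I7|].
          eapply reach_trans; [apply reach_jz, I8|].
          rewrite upd_same. simpl (_ =? _). cbv iota. exact Hr3. }
      + intros r Hr. rewrite !upd_other by lia. rewrite Hp2 by lia. auto.
      + rewrite upd_other, upd_other, upd_same by lia. simpl.
        rewrite upd_other by lia. rewrite Hp2 by lia. lia.
      + rewrite upd_other, upd_same by lia. simpl.
        rewrite !upd_other by lia. rewrite Hp2 by lia. lia.
      + rewrite !upd_other by lia. rewrite upd_same. simpl. exact Hy2. }
  edestruct (Hloop (rho x) 0) as (rho3 & Hr3 & Hy3 & Hp3); [lia| | | | |].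
  5:{ exists rho3. split; [|split; [rewrite <- Hwn; exact Hy3|exact Hp3]].
      eapply reach_trans; [exact Hr1|].
      eapply reach_trans; [apply reach_asg, I1|].
      eapply reach_trans; [apply reach_asg, I2|].
      replace (S (S (p + length c1))) with l by (unfold l; lia).
      match goal with |- reach _ _ (?q, _) =>
        replace q with (S (l + length c2 + 5)) end; [exact Hr3|].
      rewrite !length_app. simpl. rewrite length_app. simpl. unfold l. lia. }
  - intros r Hr. rewrite !upd_other by lia. auto.
  - rewrite upd_other, upd_same by lia. reflexivity.
  - rewrite upd_same. simpl. rewrite upd_other by lia. auto.
  - rewrite !upd_other by lia. exact Hy1.
Qed.

(** Register [b] holds the candidate and [S b] the value of [f] there; the induction is on the
    number [m] of candidates still to be rejected. *)
Lemma simulates_mu P f : simulates P f -> simulates P (RMu f).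
Proof.
  intros Hf xs b p y rho Hc Hx Hev. inversion Hev as [| | | | | |? ? ? H0 Hlt]; subst.
  simpl in Hc |- *. set (c := comp f (b :: xs) (S b) (S p)) in *.
  apply code_at_cons in Hc as [I1 Hc]. apply code_at_app in Hc as [Hc1 Hc].
  apply code_at_cons in Hc as [I2 Hc]. apply code_at_cons in Hc as [I3 Hc].
  apply code_at_cons in Hc as [I4 Hc]. apply code_at_cons in Hc as [I5 _].
  assert (Hloop : forall m i rho0, i + m = y ->
     (forall r, r < b -> rho0 r = rho r) -> rho0 b = i ->
     exists rho', reach P (S p, rho0) (S (p + length c + 4), rho') /\
       rho' b = y /\ forall r, r < b -> rho' r = rho r).
  { induction m as [|m IHm]; intros i rho0 Hi Hp0 Hib;
      assert (Hxs0 : map rho0 xs = map rho xs) by (eapply map_ext_below; eauto).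
    - destruct (Hf (b :: xs) (S b) (S p) 0 rho0 Hc1) as (rho2 & Hr2 & Hy2 & Hp2).
      { constructor; [lia|]. eapply Forall_lt_weaken; [|exact Hx]. lia. }
      { simpl. rewrite Hxs0, Hib. replace i with y by lia. exact H0. }
      exists rho2. split; [|split].
      + eapply reach_trans; [exact Hr2|]. eapply reach_trans; [apply reach_jz, I2|].
        rewrite Hy2. apply reach_refl.
      + rewrite Hp2 by lia. lia.
      + intros r Hr. rewrite Hp2 by lia. auto.
    - destruct (Hlt i) as [k Hk]; [lia|].
      destruct (Hf (b :: xs) (S b) (S p) (S k) rho0 Hc1) as (rho2 & Hr2 & Hy2 & Hp2).
      { constructor; [lia|]. eapply Forall_lt_weaken; [|exact Hx]. lia. }
      { simpl. rewrite Hxs0, Hib. exact Hk. }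
      edestruct (IHm (S i)) as (rho3 & Hr3 & Hy3 & Hp3); [lia| | |].
      3:{ exists rho3. split; [|split; [exact Hy3|exact Hp3]].
          eapply reach_trans; [exact Hr2|].
          eapply reach_trans; [apply reach_jz, I2|]. rewrite Hy2. simpl (_ =? _). cbv iota.
          eapply reach_trans; [apply reach_asg, I3|].
          eapply reach_trans; [apply reach_asg, I4|].
          eapply reach_trans; [apply reach_jz, I5|].
          rewrite upd_same. simpl (_ =? _). cbv iota. exact Hr3. }
      + intros r Hr. rewrite !upd_other by lia. rewrite Hp2 by lia. auto.
      + rewrite upd_other, upd_same by lia. simpl. rewrite Hp2 by lia. lia. }
  edestruct (Hloop y 0) as (rho3 & Hr3 & Hy3 & Hp3); [lia| | |].
  3:{ exists rho3. split; [|split; [exact Hy3|exact Hp3]].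
      eapply reach_trans; [apply reach_asg, I1|].
      match goal with |- reach _ _ (?q, _) =>
        replace q with (S (p + length c + 4)) end; [exact Hr3|].
      rewrite length_app. simpl. lia. }
  - intros r Hr. now rewrite upd_other by lia.
  - now rewrite upd_same.
Qed.

Lemma simulates_comp P f gs : simulates P f -> Forall (simulates P) gs ->
  simulates P (RComp f gs).
Proof.
  intros Hf Hgs xs b p y rho Hc Hx Hev.
  inversion Hev as [| | |? ? ? ys ? Hys Hy| | |]; subst.
  rewrite comp_RComp in Hc |- *.
  apply code_at_app in Hc as [Hc1 Hc]. apply code_at_app in Hc as [Hc2 Hc].
  apply code_at_cons in Hc as [I1 _].
  destruct (simulates_list P gs Hgs xs b b p ys rho Hc1 Hx (le_n b) Hys)
    as (rho1 & Hr1 & Hy1 & Hp1).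
  destruct (Hf _ _ _ y rho1 Hc2) as (rho2 & Hr2 & Hy2 & Hp2).
  { apply Forall_forall. intros r Hr. apply in_seq in Hr. lia. }
  { now rewrite Hy1. }
  eexists. split; [|split].
  - eapply reach_trans; [exact Hr1|]. eapply reach_trans; [exact Hr2|].
    rewrite !length_app. simpl length. rewrite !Nat.add_assoc, Nat.add_1_r.
    apply reach_asg, I1.
  - rewrite upd_same. exact Hy2.
  - intros r Hr. rewrite upd_other by lia. rewrite Hp2 by lia. auto.
Qed.

Lemma simulates_all P f : simulates P f.
Proof.
  induction f as [| |i|f gs IHf IHgs|f g IHf IHg|f IHf] using rf_ind_nested.
  - intros xs b p y rho Hc Hx Hev. apply code_at_cons in Hc as [I1 _].
    inversion Hev; subst. eexists. split; [|split].
    + simpl. rewrite Nat.add_1_r. apply reach_asg, I1.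
    + now rewrite upd_same.
    + intros r Hr. apply upd_other. lia.
  - intros xs b p y rho Hc Hx Hev. destruct xs as [|x xs]; inversion Hev; subst.
    apply code_at_cons in Hc as [I1 _]. eexists. split; [|split].
    + simpl. rewrite Nat.add_1_r. apply reach_asg, I1.
    + now rewrite upd_same.
    + intros r Hr. apply upd_other. lia.
  - intros xs b p y rho Hc Hx Hev. inversion Hev; subst. simpl in Hc |- *.
    destruct (nth_error xs i) as [x|] eqn:E;
      apply code_at_cons in Hc as [I1 _]; eexists; (split; [|split]).
    + simpl. rewrite Nat.add_1_r. apply reach_asg, I1.
    + rewrite upd_same. simpl. symmetry. apply nth_error_nth.
      rewrite nth_error_map, E. reflexivity.
    + intros r Hr. apply upd_other. lia.
    + simpl. rewrite Nat.add_1_r. apply reach_asg, I1.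
    + rewrite upd_same. simpl. symmetry. apply nth_overflow.
      rewrite length_map. now apply nth_error_None.
    + intros r Hr. apply upd_other. lia.
  - now apply simulates_comp.
  - now apply simulates_prim.
  - now apply simulates_mu.
Qed.

(** * Acceptance by register machines *)

Definition init_config (n : nat) : config := (0, fun i => if i =? 0 then n else 0).

Definition accepts (P : list instr) (n : nat) : Prop :=
  exists t, fst (run P t (init_config n)) = length P.

(* The last instruction loops on itself as long as the output register is zero. *)
Definition machine (f : rf) : list instr :=
  let c := comp f [0] 1 0 in c ++ [Jz 1 (length c)].

Lemma machine_out f n y : eval f [n] y ->
  exists t rho, run (machine f) t (init_config n) = (length (comp f [0] 1 0), rho) /\
    rho 1 = y.
Proof.
  intros H. destruct (simulates_all (machine f) f [0] 1 0 y (snd (init_config n)))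
    as (rho & [t Ht] & Hy & _).
  - intros i Hi. unfold machine. simpl. now rewrite nth_error_app1.
  - repeat constructor.
  - exact H.
  - exists t, rho. split; assumption.
Qed.

Lemma machine_last f : nth_error (machine f) (length (comp f [0] 1 0)) =
  Some (Jz 1 (length (comp f [0] 1 0))).
Proof. unfold machine. now rewrite nth_error_app2, Nat.sub_diag. Qed.

Lemma run_stuck P t c : step P c = c -> run P t c = c.
Proof. intros H. induction t; simpl; auto. unfold run in *. simpl. now rewrite IHt. Qed.

Lemma run_halted P t u c : nth_error P (fst (run P t c)) = None -> t <= u ->
  run P u c = run P t c.
Proof.
  intros H Hu. replace u with ((u - t) + t) by lia. rewrite run_add.
  apply run_stuck. unfold step. now rewrite H.
Qed.

(** If [y] is zero, the final [Jz] is a fixed point of [step] and is never left; an earlier halt is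
    excluded too, since by [run_halted] it would persist until the time when that instruction is
    reached. *)
Lemma machine_accepts f n y : eval f [n] y -> accepts (machine f) n <-> y <> 0.
Proof.
  intros H. destruct (machine_out f n y H) as (t & rho & Ht & Hy).
  assert (HL : length (machine f) = S (length (comp f [0] 1 0))).
  { unfold machine. rewrite length_app. simpl. lia. }
  split.
  - intros [u Hu] Hy0.
    assert (Hs : step (machine f) (length (comp f [0] 1 0), rho) =
      (length (comp f [0] 1 0), rho)).
    { unfold step. simpl. rewrite machine_last, Hy, Hy0. reflexivity. }
    destruct (Nat.le_gt_cases t u) as [Hle|Hlt].
    + replace u with ((u - t) + t) in Hu by lia.
      rewrite run_add, Ht, run_stuck in Hu by exact Hs. simpl in Hu. lia.
    + rewrite (run_halted _ u t) in Ht; [|apply nth_error_None; lia|lia].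
      rewrite Ht in Hu. simpl in Hu. lia.
  - intros Hy0. exists (1 + t). rewrite run_add, Ht. unfold run, step. simpl.
    rewrite machine_last. simpl. rewrite HL.
    destruct (Nat.eqb_spec (rho 1) 0); [congruence|reflexivity].
Qed.

(** * Computation tables *)

(* Atoms describe a cell of a computation table; the table is read row by row, and the
   cell of offset [m] in row [t] stands for the number [m] at time [t]. *)
Inductive atom : Type :=
| AH      (* first cell of a row *)
| AF      (* cell of the first row *)
| AU      (* cell at most the input *)
| ALH     (* last cell of a row *)
| AQ (q : nat)    (* the program counter is [q] *)
| AR (i : nat)    (* register [i] holds the offset of this cell *)
| AP (i : nat)    (* [AR i] at the previous cell *)
| AL (i : nat).   (* [AR i] at the next cell *)

(* The names 0 and 1 are kept for the two chains of cells. *)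
Definition anum (a : atom) : nat :=
  match a with
  | AH => 2 | AF => 3 | AU => 4 | ALH => 5
  | AQ q => 6 + 4 * q | AR i => 7 + 4 * i | AP i => 8 + 4 * i | AL i => 9 + 4 * i
  end.

Lemma anum_inj a b : anum a = anum b -> a = b.
Proof.
  destruct a, b; cbn [anum]; intros H; try reflexivity; try (exfalso; lia);
    f_equal; lia.
Qed.

Lemma anum_ge a : 2 <= anum a.
Proof. destruct a; cbn [anum]; lia. Qed.

Inductive bform : Type :=
| BTrue : bform
| BAtom : atom -> bform
| BNot : bform -> bform
| BAnd : bform -> bform -> bform.

Definition BOr f g := BNot (BAnd (BNot f) (BNot g)).
Definition BImp f g := BNot (BAnd f (BNot g)).
Definition BIff f g := BAnd (BImp f g) (BImp g f).
Definition BBool (b : bool) := if b then BTrue else BNot BTrue.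

Definition valuation : Type := atom -> Prop.

Fixpoint bsem (v : valuation) (f : bform) : Prop :=
  match f with
  | BTrue => True
  | BAtom a => v a
  | BNot f => ~ bsem v f
  | BAnd f g => bsem v f /\ bsem v g
  end.

Lemma bsem_or v f g : bsem v (BOr f g) <-> bsem v f \/ bsem v g.
Proof. simpl. tauto. Qed.

Lemma bsem_imp v f g : bsem v (BImp f g) <-> (bsem v f -> bsem v g).
Proof. simpl. tauto. Qed.

Lemma bsem_iff v f g : bsem v (BIff f g) <-> (bsem v f <-> bsem v g).
Proof. simpl. tauto. Qed.

Lemma bsem_bool v b : bsem v (BBool b) <-> b = true.
Proof. destruct b; simpl; intuition congruence. Qed.

(** A rule is a one-way implication between two cells, because this is what [link] can express from
    a node that sees both. *)
Definition obeys (l : list (bform * bform)) (v v' : valuation) : Prop :=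
  forall f g, In (f, g) l -> bsem v f -> bsem v' g.

Lemma obeys_app l l' v v' : obeys (l ++ l') v v' <-> obeys l v v' /\ obeys l' v v'.
Proof.
  unfold obeys. split.
  - intros H; split; intros f g Hi Hf; apply (H f g); auto; apply in_or_app; auto.
  - intros [H H'] f g Hi Hf. apply in_app_or in Hi as [Hi|Hi]; eauto.
Qed.

Lemma obeys_cons f g l v v' :
  obeys ((f, g) :: l) v v' <-> (bsem v f -> bsem v' g) /\ obeys l v v'.
Proof.
  unfold obeys. split.
  - intros H; split; [apply H; now left|]. intros f' g' Hi; apply H; now right.
  - intros [H H'] f' g' [Hi|Hi] Hf; [inversion Hi; subst; auto|eauto].
Qed.

Lemma obeys_nil v v' : obeys [] v v' <-> True.
Proof. split; auto. intros _ f g []. Qed.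

Lemma obeys_flat_map {X} (h : X -> list (bform * bform)) xs v v' :
  obeys (flat_map h xs) v v' <-> forall x, In x xs -> obeys (h x) v v'.
Proof.
  unfold obeys. split.
  - intros H x Hx f g Hi. apply H. apply in_flat_map. now exists x.
  - intros H f g Hi. apply in_flat_map in Hi as (x & Hx & Hi). now apply (H x).
Qed.

(** An equivalence split into two one-way rules. Guard and negation are both read at the first cell,
    so copying premises between the chains also transfers the negative case. *)
Definition guarded (c f : bform) (a : atom) : list (bform * bform) :=
  [(BAnd c f, BAtom a); (BAnd c (BNot f), BNot (BAtom a))].

Lemma obeys_guarded c f a v v' :
  obeys (guarded c f a) v v' <-> (bsem v c -> (v' a <-> bsem v f)).
Proof.
  unfold guarded. rewrite !obeys_cons, obeys_nil. simpl. tauto.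
Qed.

Section Rules.
Variables (P : list instr) (M : nat).

(** The chain runs on from row to row, so [AP] at the head of a row and [AL] at its end speak of
    another row; [AH] and [ALH] exclude these cases. The last disjunct of [Pred] is the convention
    that the predecessor of zero is zero. *)
Definition op_form (o : op) : bform :=
  match o with
  | Zero => BAtom AH
  | Copy i => BAtom (AR i)
  | Succ i => BAnd (BAtom (AP i)) (BNot (BAtom AH))
  | Pred i => BOr (BAnd (BAtom (AL i)) (BNot (BAtom ALH))) (BAnd (BAtom AH) (BAtom (AR i)))
  end.

Definition reg_form (q j : nat) : bform :=
  match nth_error P q with
  | Some (Asg j' o) => if j =? j' then op_form o else BAtom (AR j)
  | _ => BAtom (AR j)
  end.

(** To be read at the head of a row, where [AR i] says that register [i] is zero. The horizontal
    rules spread the resulting counter over the row. *)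
Definition next_form (q q' : nat) : bform :=
  match nth_error P q with
  | Some (Asg _ _) => BBool (q' =? S q)
  | Some (Jz i l) => BOr (BAnd (BAtom (AR i)) (BBool (q' =? l)))
                         (BAnd (BNot (BAtom (AR i))) (BBool (q' =? S q)))
  | None => BBool (q' =? q)
  end.

(** Keeping acceptance out of the first row ensures that this row, and with it the input cell, lies
    before the accepting cell. *)
Definition acc_form : bform := BAnd (BAtom (AQ (length P))) (BNot (BAtom AF)).

(** An increment at the last offset would push the mark of the register out of the row and lose its
    value. *)
Definition overflow_form (q : nat) : bform :=
  match nth_error P q with
  | Some (Asg _ (Succ i)) => BNot (BAnd (BAtom (AQ q)) (BAnd (BAtom (AR i)) (BAtom ALH)))
  | _ => BTrue
  end.

Definition vrules : list (bform * bform) :=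
  [(BTrue, BNot (BAtom AF))] ++ guarded BTrue (BAtom AH) AH ++
  flat_map (fun q => flat_map (fun i => guarded (BAtom (AQ q)) (reg_form q i) (AR i)) (seq 0 M))
    (seq 0 M) ++
  flat_map (fun q => flat_map (fun q' =>
    guarded (BAnd (BAtom (AQ q)) (BAtom AH)) (next_form q q') (AQ q')) (seq 0 M)) (seq 0 M).

(** The second rule leaves the initial cell as the only head in the first row. [AU] serves to make
    the input unique: once lost it never returns, and a cell with [AR 0] removes it from the next
    cell. *)
Definition hrules : list (bform * bform) :=
  [(BNot (BAtom AF), BNot (BAtom AF));
   (BAtom AF, BNot (BAnd (BAtom AF) (BAtom AH)));
   (BNot (BAtom AU), BNot (BAtom AU));
   (BAtom (AR 0), BNot (BAtom AU))] ++
  guarded BTrue (BAtom ALH) AH ++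
  flat_map (fun q => guarded (BNot (BAtom ALH)) (BAtom (AQ q)) (AQ q)) (seq 0 M) ++
  flat_map (fun i => guarded BTrue (BAtom (AR i)) (AP i)) (seq 0 M) ++
  flat_map (fun i => guarded BTrue (BAtom (AL i)) (AR i)) (seq 0 M).

Definition crules : list bform :=
  [BImp (BAnd (BAtom AF) (BAtom (AR 0))) (BAtom AU)] ++
  map (fun q => BImp (BAtom AF) (BIff (BAtom (AQ q)) (BBool (q =? 0)))) (seq 0 M) ++
  map (fun i => BImp (BAtom AF) (BIff (BAtom (AR (S i))) (BAtom AH))) (seq 0 (pred M)) ++
  map overflow_form (seq 0 M).

Lemma vrules_spec v v' : obeys vrules v v' <->
  ~ v' AF /\ (v' AH <-> v AH) /\
  (forall q i, q < M -> i < M -> v (AQ q) -> (v' (AR i) <-> bsem v (reg_form q i))) /\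
  (forall q q', q < M -> q' < M -> v (AQ q) -> v AH ->
     (v' (AQ q') <-> bsem v (next_form q q'))).
Proof.
  unfold vrules. rewrite !obeys_app, obeys_cons, obeys_nil, obeys_guarded, !obeys_flat_map.
  setoid_rewrite obeys_flat_map. setoid_rewrite obeys_guarded. setoid_rewrite in_seq.
  simpl. split.
  - intros (H1 & H2 & H3 & H4). repeat split; try tauto.
    + apply H3; auto; lia.
    + apply H3; auto; lia.
    + apply H4; auto; lia.
    + apply H4; auto; lia.
  - intros (H1 & H2 & H3 & H4). split; [tauto|]. split; [tauto|]. split.
    + intros q Hq i Hi. apply H3; lia.
    + intros q Hq q' Hq' [Hv Hh]. apply H4; auto; lia.
Qed.

Lemma hrules_spec v v' : obeys hrules v v' <->
  (~ v AF -> ~ v' AF) /\ (v AF -> v' AF -> ~ v' AH) /\ (~ v AU -> ~ v' AU) /\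
  (v (AR 0) -> ~ v' AU) /\ (v' AH <-> v ALH) /\
  (forall q, q < M -> ~ v ALH -> (v' (AQ q) <-> v (AQ q))) /\
  (forall i, i < M -> (v' (AP i) <-> v (AR i))) /\
  (forall i, i < M -> (v' (AR i) <-> v (AL i))).
Proof.
  unfold hrules. rewrite !obeys_app, !obeys_cons, obeys_nil, obeys_guarded, !obeys_flat_map.
  setoid_rewrite obeys_guarded. setoid_rewrite in_seq. simpl. split.
  - intros ((H1 & H2 & H3 & H4 & _) & H5 & H6 & H7 & H8).
    split; [tauto|]. split; [tauto|]. split; [tauto|]. split; [tauto|]. split; [tauto|].
    split; [|split].
    + intros q Hq. apply H6. lia.
    + intros i Hi. apply H7; [lia|exact Logic.I].
    + intros i Hi. apply H8; [lia|exact Logic.I].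
  - intros (H1 & H2 & H3 & H4 & H5 & H6 & H7 & H8).
    split; [tauto|]. split; [tauto|]. split; [|split].
    + intros q Hq. apply H6. lia.
    + intros i Hi _. apply H7; lia.
    + intros i Hi _. apply H8; lia.
Qed.

Lemma crules_spec v : (forall f, In f crules -> bsem v f) <->
  (v AF -> v (AR 0) -> v AU) /\ (forall q, q < M -> v AF -> (v (AQ q) <-> q = 0)) /\
  (forall i, S i < M -> v AF -> (v (AR (S i)) <-> v AH)) /\
  (forall q, q < M -> bsem v (overflow_form q)).
Proof.
  unfold crules. setoid_rewrite in_app_iff. setoid_rewrite in_app_iff.
  setoid_rewrite in_app_iff. setoid_rewrite in_map_iff. setoid_rewrite in_seq. split.
  - intros H. split; [|split; [|split]].
    + intros Hf Hr. specialize (H _ (or_introl (or_introl eq_refl))).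
      rewrite bsem_imp in H. simpl in H. tauto.
    + intros q Hq Hf. assert (Hi : 0 <= q < 0 + M) by lia.
      specialize (H _ (or_intror (or_introl (ex_intro _ q (conj eq_refl Hi))))).
      rewrite bsem_imp, bsem_iff, bsem_bool, Nat.eqb_eq in H. apply H. exact Hf.
    + intros i Hi Hf. assert (Hi' : 0 <= i < 0 + pred M) by lia.
      specialize (H _ (or_intror (or_intror (or_introl (ex_intro _ i (conj eq_refl Hi')))))).
      rewrite bsem_imp, bsem_iff in H. apply H. exact Hf.
    + intros q Hq. apply H. right; right; right. exists q. split; [reflexivity|lia].
  - intros (H1 & H2 & H3 & H4) f [[Hf|[]]|[(q & Hf & Hq)|[(i & Hf & Hi)|(q & Hf & Hq)]]]; subst f.
    + rewrite bsem_imp. simpl. tauto.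
    + rewrite bsem_imp, bsem_iff, bsem_bool, Nat.eqb_eq. intros Hf. apply H2; [lia|exact Hf].
    + rewrite bsem_imp, bsem_iff. intros Hf. apply H3; [lia|exact Hf].
    + apply H4. lia.
Qed.

Definition op_below (o : op) : Prop :=
  match o with Zero => True | Copy i | Succ i | Pred i => i < M end.

Definition instr_below (x : instr) : Prop :=
  match x with Asg j o => j < M /\ op_below o | Jz i l => i < M /\ l < M end.

Definition below : Prop := Forall instr_below P /\ length P < M.

Lemma below_nth q x : below -> nth_error P q = Some x -> instr_below x.
Proof.
  intros [H _] Hq. rewrite Forall_forall in H. eapply H, nth_error_In, Hq.
Qed.

Definition cell_ok (N m : nat) (c : config) (v : valuation) : Prop :=
  (v AH <-> m = 0) /\ (v ALH <-> S m = N) /\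
  (forall i, i < M -> (v (AR i) <-> m = snd c i)) /\
  (forall i, i < M -> 0 < m -> (v (AP i) <-> pred m = snd c i)) /\
  (forall i, i < M -> S m < N -> (v (AL i) <-> S m = snd c i)).

Lemma reg_form_spec N m c v i : below -> m < N -> (forall i, i < M -> snd c i < N) ->
  cell_ok N m c v -> i < M ->
  (bsem v (reg_form (fst c) i) <-> m = snd (step P c) i).
Proof.
  intros HP Hm Hc (HH & HLH & HR & HPv & HL) Hi. unfold reg_form, step.
  destruct (nth_error P (fst c)) as [[j o|k l]|] eqn:E; try (simpl; now apply HR).
  simpl snd. unfold upd.
  destruct (Nat.eqb_spec i j) as [->|Hij]; [|now apply HR].
  apply (below_nth _ _ HP) in E as [_ Ho].
  destruct o as [|k|k|k]; simpl opval; simpl op_form; simpl in Ho.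
  - exact HH.
  - now apply HR.
  - simpl. rewrite HH. destruct (Nat.eq_dec m 0) as [->|Hm0]; [intuition lia|].
    rewrite HPv by lia. lia.
  - rewrite bsem_or. simpl. rewrite HH, HLH, HR by assumption.
    specialize (Hc k Ho).
    destruct (Nat.eq_dec (S m) N) as [e|ne]; [lia|].
    rewrite HL by lia. lia.
Qed.

Lemma next_form_spec N c v q : below -> cell_ok N 0 c v ->
  (bsem v (next_form (fst c) q) <-> q = fst (step P c)).
Proof.
  intros HP (HH & HLH & HR & HPv & HL). unfold next_form, step.
  destruct (nth_error P (fst c)) as [[j o|k l]|] eqn:E; simpl fst.
  - rewrite bsem_bool, Nat.eqb_eq. reflexivity.
  - apply (below_nth _ _ HP) in E as [Hk Hl].
    rewrite bsem_or. simpl bsem. rewrite !bsem_bool, !Nat.eqb_eq, HR by assumption.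
    destruct (Nat.eqb_spec (snd c k) 0); intuition lia.
  - rewrite bsem_bool, Nat.eqb_eq. reflexivity.
Qed.

Lemma run_pc_below n t : below -> fst (run P t (init_config n)) < M.
Proof.
  intros HP. induction t as [|t IH]; [simpl; destruct HP; lia|].
  change (run P (S t) (init_config n)) with (step P (run P t (init_config n))).
  set (c := run P t (init_config n)) in *. unfold step.
  destruct (nth_error P (fst c)) as [[j o|k l]|] eqn:E; simpl; auto.
  - assert (fst c < length P) by (apply nth_error_Some; congruence). destruct HP; lia.
  - assert (fst c < length P) by (apply nth_error_Some; congruence).
    apply (below_nth _ _ HP) in E as [_ Hl]. destruct (_ =? _); [exact Hl|destruct HP; lia].
Qed.

(** One finite sequence carries both directions: [S j] is to the right of [j], [j + N] is below it.
    The last row may be cut off at [K]. *)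
Record table (n N K : nat) (v : nat -> valuation) : Prop := {
  table_start : v 0 AH /\ v 0 AF;
  table_cell : forall j, j <= K -> forall f, In f crules -> bsem (v j) f;
  table_h : forall j, j < K -> obeys hrules (v j) (v (S j));
  table_v : forall j, j + N <= K -> obeys vrules (v j) (v (j + N));
  table_first : forall j, j < N -> j <= K -> v j AF;
  table_acc : bsem (v K) acc_form;
  table_input : n <= K /\ v n AF /\ v n (AR 0) }.

(** * From tables to accepting runs *)

Section Sound.
Variables (n N K : nat) (v : nat -> valuation).
Hypothesis (HP : below) (T : table n N K v).

Let cfg t := run P t (init_config n).

(** With width zero, cell 0 would lie below itself, and a cell below another one is not in the first
    row. *)
Lemma table_width : 0 < N.
Proof.
  destruct (Nat.eq_dec N 0) as [e|]; [|lia]. exfalso.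
  pose proof (table_v _ _ _ _ T 0) as H. rewrite vrules_spec in H.
  rewrite e in H. apply H; [lia|]. apply (table_start _ _ _ _ T).
Qed.

Lemma table_F j : j <= K -> (v j AF <-> j < N).
Proof.
  intros Hj. split; [|intros; now apply (table_first _ _ _ _ T)].
  intros HF. destruct (Nat.lt_ge_cases j N) as [|Hge]; [assumption|]. exfalso.
  pose proof (table_v _ _ _ _ T (j - N)) as H. rewrite vrules_spec in H.
  replace (j - N + N) with j in H by lia. now apply H.
Qed.

Lemma table_H t m : m < N -> t * N + m <= K -> (v (t * N + m) AH <-> m = 0).
Proof.
  intros Hm. induction t as [|t IH]; simpl; intros Ht.
  - destruct m as [|m]; [pose proof (table_start _ _ _ _ T); intuition|].
    split; [|lia]. intros HH. exfalso.
    pose proof (table_h _ _ _ _ T m) as H. rewrite hrules_spec in H.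
    destruct H as (_ & H & _); [lia|]. revert HH. apply H; apply table_F; lia.
  - pose proof (table_v _ _ _ _ T (t * N + m)) as H. rewrite vrules_spec in H.
    replace (N + t * N + m) with (t * N + m + N) by lia.
    destruct H as (_ & H & _); [lia|]. rewrite H. apply IH. lia.
Qed.

Lemma table_LH t m : m < N -> t * N + S m <= K -> (v (t * N + m) ALH <-> S m = N).
Proof.
  intros Hm Ht. pose proof (table_h _ _ _ _ T (t * N + m)) as H. rewrite hrules_spec in H.
  destruct H as (_ & _ & _ & _ & H & _); [lia|]. rewrite <- H.
  destruct (Nat.eq_dec (S m) N) as [e|ne].
  - replace (S (t * N + m)) with (S t * N + 0) by (simpl; lia). rewrite table_H; lia.
  - replace (S (t * N + m)) with (t * N + S m) by lia. rewrite table_H; lia.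
Qed.

Definition row_ok (t : nat) : Prop := forall m, m < N -> t * N + m <= K ->
  (forall q, q < M -> (v (t * N + m) (AQ q) <-> q = fst (cfg t))) /\
  (forall i, i < M -> (v (t * N + m) (AR i) <-> m = snd (cfg t) i)).

Lemma row_cell_ok t m : row_ok t -> S t * N <= K -> m < N ->
  cell_ok N m (cfg t) (v (t * N + m)).
Proof.
  intros Hr Ht Hm. simpl in Ht.
  split; [apply table_H; lia|]. split; [apply table_LH; lia|].
  split; [|split]; intros i Hi.
  - apply Hr; lia.
  - intros Hm0. destruct m as [|m]; [lia|].
    pose proof (table_h _ _ _ _ T (t * N + m)) as H. rewrite hrules_spec in H.
    destruct H as (_ & _ & _ & _ & _ & _ & H & _); [lia|].
    replace (t * N + S m) with (S (t * N + m)) by lia. rewrite H by assumption.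
    apply Hr; lia.
  - intros Hm1. pose proof (table_h _ _ _ _ T (t * N + m)) as H. rewrite hrules_spec in H.
    destruct H as (_ & _ & _ & _ & _ & _ & _ & H); [lia|].
    rewrite <- H by assumption.
    replace (S (t * N + m)) with (t * N + S m) by lia. apply Hr; lia.
Qed.

Lemma U_mono j k : j <= k -> k <= K -> ~ v j AU -> ~ v k AU.
Proof.
  induction 1 as [|k Hjk IH]; auto. intros Hk Hj.
  pose proof (table_h _ _ _ _ T k) as H. rewrite hrules_spec in H.
  destruct H as (_ & _ & H & _); [lia|]. apply H, IH; [lia|exact Hj].
Qed.

Lemma input_width : n < N.
Proof. destruct (table_input _ _ _ _ T) as (H & HF & _). now apply table_F. Qed.

(** Only register 0 needs an argument. The input puts [AR 0] at offset [n]; of two such cells in the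
    row, the left one would remove [AU] from all later cells, while the right one requires it. *)
Lemma first_row_ok : row_ok 0.
Proof.
  intros m Hm Hk. simpl in *.
  assert (HF : v m AF) by (apply table_F; lia).
  pose proof (table_cell _ _ _ _ T m Hk) as H. rewrite crules_spec in H.
  destruct H as (HU & HQ & HR & _). split; [intros q Hq; now apply HQ|].
  intros [|i] Hi; simpl.
  2:{ rewrite HR by assumption. apply (table_H 0 m); simpl; lia. }
  destruct (table_input _ _ _ _ T) as (Hn & HnF & HnR).
  assert (Hstop : forall j, j < K -> v j (AR 0) -> ~ v (S j) AU).
  { intros j Hj. pose proof (table_h _ _ _ _ T j Hj) as H. rewrite hrules_spec in H. tauto. }
  assert (HnU : v n AU).
  { pose proof (table_cell _ _ _ _ T n Hn) as H. rewrite crules_spec in H. now apply H. }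
  split; [|now intros ->]. intros HmR.
  destruct (Nat.lt_trichotomy m n) as [Hlt|[He|Hgt]]; [|exact He|]; exfalso.
  - apply (U_mono (S m) n); auto; try lia. apply Hstop; auto; lia.
  - apply (U_mono (S n) m); auto; try lia. apply Hstop; auto; lia.
Qed.

(** The bound must be carried along with the invariant: [reg_form_spec] needs it for [Pred] at the
    last offset, and it survives a [Succ] only because the row below exists only if no overflow
    occurs. *)
Lemma rows_ok t : t * N <= K -> row_ok t /\ forall i, i < M -> snd (cfg t) i < N.
Proof.
  pose proof table_width as HN.
  induction t as [|t IH]; intros Ht.
  - split; [apply first_row_ok|]. intros i _. pose proof input_width. simpl.
    destruct (_ =? _); lia.
  - simpl in Ht. destruct IH as [Hr Hb]; [lia|].
    assert (Hc : forall m, m < N -> cell_ok N m (cfg t) (v (t * N + m))).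
    { intros m Hm. apply row_cell_ok; auto. }
    assert (Hpc : fst (cfg t) < M) by (apply run_pc_below; exact HP).
    assert (HQt : forall m, m < N -> v (t * N + m) (AQ (fst (cfg t)))).
    { intros m Hm. apply Hr; auto; lia. }
    change (cfg (S t)) with (step P (cfg t)). split.
    + intros m Hm Hk.
      change (S t * N) with (N + t * N) in Hk.
      assert (Hv : forall m, m < N -> S t * N + m <= K ->
        obeys vrules (v (t * N + m)) (v (S t * N + m))).
      { intros m' Hm' Hk'. replace (S t * N + m') with (t * N + m' + N) by (simpl; lia).
        apply (table_v _ _ _ _ T). simpl in Hk'. lia. }
      change (cfg (S t)) with (step P (cfg t)). split.
      (* The vertical rule fixes the counter at the head; the induction carries it along the row. *)
      * intros q Hq. induction m as [|m IHm].
        -- specialize (Hv 0 Hm Hk). rewrite vrules_spec in Hv. destruct Hv as (_ & _ & _ & Hv).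
           rewrite (Hv (fst (cfg t)) q); auto.
           ++ eapply next_form_spec; eauto.
           ++ apply table_H; lia.
        -- rewrite <- IHm by lia.
           pose proof (table_h _ _ _ _ T (S t * N + m)) as H. rewrite hrules_spec in H.
           destruct H as (_ & _ & _ & _ & _ & H & _); [simpl; lia|].
           replace (S t * N + S m) with (S (S t * N + m)) by lia.
           apply H; auto. rewrite table_LH by (simpl; lia). lia.
      * intros i Hi. specialize (Hv m Hm Hk). rewrite vrules_spec in Hv.
        destruct Hv as (_ & _ & Hv & _). rewrite (Hv (fst (cfg t)) i); auto.
        eapply reg_form_spec; eauto.
    + intros i Hi. unfold step.
      destruct (nth_error P (fst (cfg t))) as [[j o|k l]|] eqn:E; simpl snd; auto.
      unfold upd. destruct (Nat.eqb_spec i j) as [->|]; auto.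
      destruct (below_nth _ _ HP E) as [_ Ho].
      destruct o as [|k|k|k]; simpl in Ho |- *; auto.
      2:{ specialize (Hb k Ho). lia. }
      assert (Hk := Hb k Ho).
      destruct (Nat.eq_dec (S (snd (cfg t) k)) N) as [e|]; [|lia]. exfalso.
      pose proof (table_cell _ _ _ _ T (t * N + snd (cfg t) k)) as H.
      rewrite crules_spec in H. destruct H as (_ & _ & _ & H); [lia|].
      specialize (H _ Hpc). unfold overflow_form in H. rewrite E in H. apply H.
      split; [|split]; simpl.
      * now apply HQt.
      * apply Hr; auto; lia.
      * apply table_LH; lia.
Qed.

Lemma table_accepts : accepts P n.
Proof.
  pose proof table_width as HN. exists (K / N).
  pose proof (Nat.div_mod_eq K N) as HK. pose proof (Nat.mod_upper_bound K N) as Hm.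
  destruct (rows_ok (K / N)) as [Hr _]; [lia|].
  destruct (Hr (K mod N)) as [HQ _]; [lia|lia|].
  pose proof (table_acc _ _ _ _ T) as [HA _].
  replace (K / N * N + K mod N) with K in HQ by lia.
  symmetry. apply HQ; [|exact HA]. apply HP.
Qed.

End Sound.
End Rules.

(** * From accepting runs to tables *)

Section Complete.
Variables (P : list instr) (M n N : nat).
Hypothesis (HP : below P M) (HN : 0 < N).

Let cfg t := run P t (init_config n).

Definition reg_at (j i : nat) : Prop := j mod N = snd (cfg (j / N)) i.

Definition std_table (j : nat) : valuation := fun a =>
  match a with
  | AH => j mod N = 0
  | AF => j < N
  | AU => j <= n
  | ALH => S j mod N = 0
  | AQ q => q = fst (cfg (j / N))
  | AR i => reg_at j i
  | AP i => 0 < j /\ reg_at (pred j) i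
  | AL i => reg_at (S j) i
  end.

Lemma row_div t m : m < N -> (t * N + m) / N = t.
Proof. intros H. symmetry. apply Nat.div_unique with m; lia. Qed.

Lemma row_mod t m : m < N -> (t * N + m) mod N = m.
Proof. intros H. symmetry. apply Nat.mod_unique with t; lia. Qed.

Lemma row_split j : exists t m, m < N /\ j = t * N + m.
Proof.
  exists (j / N), (j mod N). pose proof (Nat.div_mod_eq j N).
  pose proof (Nat.mod_upper_bound j N). lia.
Qed.

Lemma next_row_start t m : m < N -> (S (t * N + m) mod N = 0 <-> S m = N).
Proof.
  intros Hm. destruct (Nat.eq_dec (S m) N) as [e|ne].
  - replace (S (t * N + m)) with (S t * N + 0) by (simpl; lia). rewrite row_mod; lia.
  - replace (S (t * N + m)) with (t * N + S m) by lia. rewrite row_mod; lia.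
Qed.

Lemma std_table_cell_ok t m : m < N -> cell_ok M N m (cfg t) (std_table (t * N + m)).
Proof.
  intros Hm. unfold cell_ok, std_table, reg_at. rewrite row_mod, row_div by assumption.
  split; [tauto|]. split; [now apply next_row_start|]. split; [tauto|]. split.
  - intros i _ Hm0. replace (pred (t * N + m)) with (t * N + pred m) by lia.
    rewrite row_mod, row_div by lia. intuition lia.
  - intros i _ Hm1. replace (S (t * N + m)) with (t * N + S m) by lia.
    rewrite row_mod, row_div by lia. tauto.
Qed.

Lemma run_reg_bound t i : snd (cfg t) i <= n + t.
Proof.
  revert i. induction t as [|t IH]; intros i.
  - simpl. destruct (_ =? _); lia.
  - change (cfg (S t)) with (step P (cfg t)). unfold step.
    destruct (nth_error P (fst (cfg t))) as [[j o|k l]|]; simpl; try (specialize (IH i); lia).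
    unfold upd. destruct (i =? j); [|specialize (IH i); lia].
    destruct o as [|k|k|k]; simpl; try specialize (IH k); lia.
Qed.

Lemma std_table_h j : n < N -> obeys (hrules M) (std_table j) (std_table (S j)).
Proof.
  intros HnN. apply hrules_spec. destruct (row_split j) as (t & m & Hm & ->).
  unfold std_table. split; [lia|]. split; [|split; [lia|split; [|split; [tauto|split; [|split]]]]].
  - intros H1 H2 H3. rewrite Nat.mod_small in H3 by assumption. lia.
  - unfold reg_at. rewrite row_div, row_mod by assumption. intros H H'.
    destruct t as [|t]; [simpl in *; lia|]. simpl in H'. lia.
  - intros q _ H. rewrite next_row_start in H by assumption.
    replace (S (t * N + m)) with (t * N + S m) by lia.
    rewrite !row_div by lia. tauto.
  - intros i _. simpl pred. intuition lia.
  - tauto.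
Qed.

Lemma std_table_v t m : m < N -> n + t < N ->
  obeys (vrules P M) (std_table (t * N + m)) (std_table (S t * N + m)).
Proof.
  intros Hm Hb.
  assert (Hok := std_table_cell_ok t m Hm).
  assert (Hpc : fst (cfg t) < M) by now apply run_pc_below.
  assert (HQ : forall q, std_table (t * N + m) (AQ q) <-> q = fst (cfg t)).
  { intros q. simpl. now rewrite row_div by assumption. }
  apply vrules_spec. split; [simpl; lia|]. split; [|split].
  - unfold std_table. rewrite !row_mod by assumption. apply iff_refl.
  - intros q i Hq Hi Hv. apply HQ in Hv as ->.
    rewrite (reg_form_spec P M N m) by
      (auto; intros k _; pose proof (run_reg_bound t k); lia).
    unfold std_table. unfold reg_at. rewrite row_div, row_mod by assumption. reflexivity.
  - intros q q' Hq Hq' Hv HH. apply HQ in Hv as ->.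
    assert (m = 0) as -> by (simpl in HH; rewrite row_mod in HH; auto).
    rewrite (next_form_spec P M N) by eauto.
    unfold std_table. rewrite row_div by assumption. reflexivity.
Qed.

Lemma std_table_cell t m : m < N -> S (n + t) < N ->
  forall f, In f (crules P M) -> bsem (std_table (t * N + m)) f.
Proof.
  intros Hm Hb. apply crules_spec. unfold std_table, reg_at.
  rewrite !row_div, !row_mod by assumption.
  assert (HF : t * N + m < N -> t = 0) by (destruct t; simpl; lia).
  split; [|split; [|split]].
  - intros H ->. rewrite (HF H). simpl. lia.
  - intros q _ H. rewrite (HF H). reflexivity.
  - intros i _ H. rewrite (HF H). reflexivity.
  - intros q _. unfold overflow_form.
    destruct (nth_error P q) as [[j [|k|k|k]|k l]|]; cbn [bsem]; auto.
    rewrite next_row_start by assumption.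
    intros (_ & Hk & HS).
    pose proof (run_reg_bound t k). lia.
Qed.

End Complete.

Lemma accepts_table P M n : below P M -> P <> [] -> accepts P n ->
  exists N K, 0 < N /\ table P M n N K (std_table P n N).
Proof.
  (* By time [t] no register exceeds [n + t], so this width keeps every value below the last offset,
     even in row [t], as [overflow_form] requires. The table ends at the head of row [t]. *)
  intros HP HP0 [t Ht]. set (N := S (S (n + t))). exists N, (t * N).
  assert (HN : 0 < N) by (unfold N; lia).
  (* The initial counter 0 is not [length P], as [P] is non-empty; hence the accepting cell is
     outside the first row. *)
  assert (Ht0 : 0 < t).
  { destruct t; [|lia]. destruct P; [congruence|discriminate]. }
  assert (HtN : N <= t * N) by (destruct t; simpl; lia).
  assert (Hrow : forall j, j <= t * N -> exists u m, m < N /\ u <= t /\ j = u * N + m).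
  { intros j Hj. destruct (row_split N HN j) as (u & m & Hm & ->).
    exists u, m. repeat split; auto. nia. }
  split; [exact HN|]. constructor.
  - unfold std_table. rewrite Nat.Div0.mod_0_l. lia.
  - intros j Hj. destruct (Hrow j Hj) as (u & m & Hm & Hu & ->).
    apply std_table_cell; auto. unfold N. lia.
  - intros j _. apply std_table_h; auto. unfold N; lia.
  - intros j Hj. destruct (Hrow j) as (u & m & Hm & Hu & ->); [lia|].
    replace (u * N + m + N) with (S u * N + m) by (simpl; lia).
    apply std_table_v; auto. unfold N; lia.
  - intros j Hj _. exact Hj.
  - unfold acc_form. cbn [bsem std_table]. rewrite Nat.div_mul by lia. split; [symmetry; exact Ht|lia].
  - cbn [std_table]. split; [unfold N in *; lia|]. split; [unfold N; lia|].
    unfold reg_at. rewrite Nat.mod_small, Nat.div_small by (unfold N; lia). reflexivity.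
Qed.

Lemma below_exists P : exists M, below P M.
Proof.
  assert (H : exists M, Forall (instr_below M) P).
  { induction P as [|x P [M HM]]; [exists 0; constructor|].
    assert (Hmono : forall m m' y, m <= m' -> instr_below m y -> instr_below m' y).
    { intros m m' [j [|k|k|k]|k l]; simpl; lia. }
    assert (Hx : exists m, instr_below m x).
    { destruct x as [j [|k|k|k]|k l]; [exists (S j)|exists (S (j + k))|exists (S (j + k))|
        exists (S (j + k))|exists (S (k + l))]; simpl; lia. }
    destruct Hx as [m Hm]. exists (m + M). constructor.
    - eapply Hmono; [|exact Hm]. lia.
    - eapply Forall_impl; [|exact HM]. intros y. apply Hmono. lia. }
  destruct H as [M HM]. exists (S (M + length P)). split; [|lia].
  eapply Forall_impl; [|exact HM].
  intros [j [|k|k|k]|k l]; simpl; lia.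
Qed.

(** * The concept of a machine *)

Fixpoint pow {D : Type} (R : D -> D -> Prop) (n : nat) (x y : D) : Prop :=
  match n with
  | 0 => x = y
  | S n => exists z, R x z /\ pow R n z y
  end.

Lemma pow_add {D} (R : D -> D -> Prop) m n x y :
  pow R (m + n) x y <-> exists z, pow R m x z /\ pow R n z y.
Proof.
  revert x. induction m as [|m IH]; intros x; simpl.
  - split; [intros H; now exists x|]. now intros (z & -> & H).
  - split.
    + intros (z & Hz & H). apply IH in H as (u & Hu & H). exists u. split; [now exists z|exact H].
    + intros (u & (z & Hz & Hu) & H). exists z. split; [exact Hz|]. apply IH. now exists u.
Qed.

Lemma pow_1 {D} (R : D -> D -> Prop) x y : pow R 1 x y <-> R x y.
Proof. simpl. split; [now intros (z & H & <-)|]. intros H. now exists y. Qed.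

Lemma pow_snoc {D} (R : D -> D -> Prop) n x y z : pow R n x y -> R y z -> pow R (S n) x z.
Proof. intros H HR. rewrite <- Nat.add_1_r. apply pow_add. exists y. now rewrite pow_1. Qed.

Notation r_of I := (i_rn I r_role).
Notation s_of I := (i_rn I s_role).

Lemma word_path_app {D} (I : interp D) w w' x y :
  word_path I (w ++ w') x y <-> exists z, word_path I w x z /\ word_path I w' z y.
Proof.
  revert x. induction w as [|[q|A] w IH]; intros x; simpl.
  - split; [intros H; now exists x|]. now intros (z & -> & H).
  - split.
    + intros (z & Hz & H). apply IH in H as (u & Hu & H). exists u. split; [now exists z|exact H].
    + intros (u & (z & Hz & Hu) & H). exists z. split; [exact Hz|]. apply IH. now exists u.
  - rewrite IH. split; [intros (H & z & Hz); now exists z|]. intros (z & Hz & H). intuition eauto.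
Qed.

Lemma word_path_repeat {D} (I : interp D) q n x y :
  word_path I (repeat (LRole q) n) x y <-> pow (i_rn I q) n x y.
Proof.
  revert x. induction n as [|n IH]; intros x; simpl; [reflexivity|].
  split; intros (z & Hz & H); exists z; (split; [exact Hz|]); now apply IH.
Qed.

Definition CAllR q C := CNeg (CExR q (CNeg C)).
Definition CAllL L C := CNeg (CExL L (CNeg C)).
Definition CImp C C' := CNeg (CAnd C (CNeg C')).
Definition CBig (l : list concept) : concept := fold_right CAnd CTop l.

Section Semantics.
Context {D : Type} (I : interp D).

Lemma csem_imp C C' d : csem I (CImp C C') d <-> (csem I C d -> csem I C' d).
Proof. simpl. split; [intros H H'; apply NNPP; tauto|tauto]. Qed.

Lemma csem_and C C' d : csem I (CAnd C C') d <-> csem I C d /\ csem I C' d.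
Proof. reflexivity. Qed.

Lemma csem_exr q C d : csem I (CExR q C) d <-> exists e, i_rn I q d e /\ csem I C e.
Proof. reflexivity. Qed.

Lemma csem_big l d : csem I (CBig l) d <-> forall C, In C l -> csem I C d.
Proof.
  induction l as [|C l IH]; simpl; [split; [intros _ C []|auto]|].
  rewrite IH. split; [intros [H H'] C' [<-|Hi]; auto|auto].
Qed.

Lemma csem_allr q C d : csem I (CAllR q C) d <-> forall e, i_rn I q d e -> csem I C e.
Proof.
  simpl. split; [|firstorder]. intros H e He. apply NNPP. eauto.
Qed.

Lemma csem_ex_rstar C d : csem I (CExL L_rstar C) d <->
  exists n e, pow (r_of I) n d e /\ csem I C e.
Proof.
  simpl. split.
  - intros (w & e & (n & ->) & Hp & He). rewrite word_path_repeat in Hp. eauto.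
  - intros (n & e & Hp & He). exists (repeat (LRole r_role) n), e.
    rewrite word_path_repeat. eauto.
Qed.

Lemma csem_all_rstar C d : csem I (CAllL L_rstar C) d <->
  forall n e, pow (r_of I) n d e -> csem I C e.
Proof.
  change (csem I (CAllL L_rstar C) d) with (~ csem I (CExL L_rstar (CNeg C)) d).
  rewrite csem_ex_rstar. split.
  - intros H n e Hp. apply NNPP. intros He. apply H. now exists n, e.
  - intros H (n & e & Hp & He). exact (He (H n e Hp)).
Qed.

Lemma csem_all_splus C d : csem I (CAllL L_splus C) d <->
  forall n e, pow (s_of I) (S n) d e -> csem I C e.
Proof.
  unfold CAllL. cbn [csem lang_words]. split.
  - intros H n e Hp. apply NNPP. intros He. apply H.
    exists (repeat (LRole s_role) (S n)), e. split; [|split; [|exact He]].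
    + exists (S n). split; [lia|reflexivity].
    + now apply word_path_repeat.
  - intros H (w & e & (n & Hn & ->) & Hp & He). destruct n as [|n]; [lia|].
    apply He, (H n). now apply word_path_repeat.
Qed.

Lemma csem_ex_rnsn C d : csem I (CExL L_rnsn C) d <->
  exists n m e, pow (r_of I) n d m /\ pow (s_of I) n m e /\ csem I C e.
Proof.
  cbn [csem lang_words]. split.
  - intros (w & e & (n & ->) & Hp & He). apply word_path_app in Hp as (m & H1 & H2).
    rewrite word_path_repeat in H1, H2. now exists n, m, e.
  - intros (n & m & e & H1 & H2 & He).
    exists (repeat (LRole r_role) n ++ repeat (LRole s_role) n), e.
    split; [now exists n|]. split; [|exact He]. apply word_path_app. exists m.
    now rewrite !word_path_repeat.
Qed.

Lemma csem_all_rnsn C d : csem I (CAllL L_rnsn C) d <->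
  forall n m e, pow (r_of I) n d m -> pow (s_of I) n m e -> csem I C e.
Proof.
  change (csem I (CAllL L_rnsn C) d) with (~ csem I (CExL L_rnsn (CNeg C)) d).
  rewrite csem_ex_rnsn. split.
  - intros H n m e H1 H2. apply NNPP. intros He. apply H. now exists n, m, e.
  - intros H (n & m & e & H1 & H2 & He). exact (He (H n m e H1 H2)).
Qed.

End Semantics.

Fixpoint bconcept (f : bform) : concept :=
  match f with
  | BTrue => CTop
  | BAtom a => CName (anum a)
  | BNot f => CNeg (bconcept f)
  | BAnd f g => CAnd (bconcept f) (bconcept g)
  end.

Definition val {D} (I : interp D) (x : D) : valuation := fun a => i_cn I (anum a) x.

Lemma csem_bconcept {D} (I : interp D) f x : csem I (bconcept f) x <-> bsem (val I x) f.
Proof.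
  induction f as [|a|f IH|f IHf g IHg]; simpl; try reflexivity.
  - now rewrite IH.
  - now rewrite IHf, IHg.
Qed.

(** An existential premise with a universal conclusion ranges over all pairs of cells seen from the
    node, so branching chains do no harm. *)
Definition link (X Y : nat) (l : list (bform * bform)) : concept :=
  CBig (map (fun p => CImp (CExL L_rnsn (CAnd (CName X) (bconcept (fst p))))
                           (CAllL L_rnsn (CImp (CName Y) (bconcept (snd p))))) l).

Definition all_rnsn_chain (Y : nat) (f : bform) : concept :=
  CAllL L_rnsn (CImp (CName Y) (bconcept f)).

Definition sees {D} (I : interp D) (d e : D) : Prop :=
  exists n m, pow (r_of I) n d m /\ pow (s_of I) n m e.

Lemma csem_link {D} (I : interp D) X Y l d : csem I (link X Y l) d <->
  forall x y, sees I d x -> sees I d y -> i_cn I X x -> i_cn I Y y ->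
  obeys l (val I x) (val I y).
Proof.
  unfold link. rewrite csem_big. setoid_rewrite in_map_iff. split.
  - intros H x y (n & m & H1 & H2) (n' & m' & H1' & H2') HX HY f g Hi Hf.
    assert (Hc := H _ (ex_intro _ (f, g) (conj eq_refl Hi))).
    rewrite csem_imp, csem_ex_rnsn, csem_all_rnsn in Hc.
    assert (Hy : csem I (CImp (CName Y) (bconcept (snd (f, g)))) y).
    { apply (Hc ltac:(exists n, m, x; split; [exact H1|split; [exact H2|split;
        [exact HX|now apply csem_bconcept]]]) n' m' y H1' H2'). }
    rewrite csem_imp in Hy. apply csem_bconcept, Hy. exact HY.
  - intros H C ((f, g) & <- & Hi). rewrite csem_imp, csem_ex_rnsn, csem_all_rnsn.
    intros (n & m & x & H1 & H2 & HX & Hf) n' m' y H1' H2'.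
    rewrite csem_imp. intros HY. apply csem_bconcept.
    apply (H x y) with (f := f); auto; [now exists n, m|now exists n', m'|].
    now apply csem_bconcept.
Qed.

Lemma csem_all_rnsn_chain {D} (I : interp D) Y f d : csem I (all_rnsn_chain Y f) d <->
  forall y, sees I d y -> i_cn I Y y -> bsem (val I y) f.
Proof.
  unfold all_rnsn_chain. rewrite csem_all_rnsn. setoid_rewrite csem_imp.
  setoid_rewrite csem_bconcept. split.
  - intros H y (n & m & H1 & H2) HY. exact (H n m y H1 H2 HY).
  - intros H n m y H1 H2 HY. apply H; [now exists n, m|exact HY].
Qed.

Section Concept.
Variables (P : list instr) (M : nat).

(** A third role lets the first nominal point to both lines without adding r- or s-edges to them. *)
Definition fork_role : role := IntRole 0.

(* The rules that carry the contents of the second chain over to the first one. *)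
Definition copy_rules : list (bform * bform) :=
  map (fun p => (fst p, fst p)) (vrules P M) ++
  [(BNot (BAtom AF), BNot (BAtom AF)); (BNot (BAtom (AR 0)), BNot (BAtom (AR 0)));
   (BNot (acc_form P), BNot (acc_form P))].

Definition cell_concept (X : nat) : concept :=
  CAnd (CName X) (CAnd (CBig (map bconcept (crules P M)))
    (CAnd (CBig (map (fun p => CImp (bconcept (fst p)) (CAllR s_role (bconcept (snd p))))
                     (hrules M)))
          (CImp (CNeg (bconcept (acc_form P))) (CExR s_role CTop)))).

(** The nominal is not a cell: cell [j] is at s-distance [S j], which matches the one r-step from
    the branching node of a line to the nominal. *)
Definition chain_concept (X : nat) : concept :=
  CAnd (CExR s_role CTop)
    (CAnd (CAllR s_role (bconcept (BAnd (BAtom AH) (BAtom AF))))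
          (CAllL L_splus (cell_concept X))).

(** Read from the far end of the line. The first [L_rstar] leads to the branching node, one r-step
    from the first nominal; the second one starts after one r-step and its length is [N]. The nodes
    on that second stretch see the first [N] cells of the second chain, which are thereby put in the
    first row. *)
Definition shift_concept : concept :=
  CAnd (CExL L_rstar (CAnd (CExR r_role (CNom 0))
          (CExR r_role (CAnd (CAllL L_rstar (all_rnsn_chain 1 (BAtom AF)))
             (CExL L_rstar (CAnd (CNom 1) (chain_concept 1)))))))
    (CAnd (CAllL L_rstar (link 0 1 (vrules P M)))
          (all_rnsn_chain 1 (acc_form P))).

Definition copy_concept : concept :=
  CAnd (CExL L_rstar (CAnd (CExR r_role (CNom 0)) (CExR r_role (CNom 1))))
    (CAnd (CAllL L_rstar (link 1 0 copy_rules))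
          (all_rnsn_chain 0 (acc_form P))).

Definition machine_concept : concept :=
  CAnd (CNom 0) (CAnd (chain_concept 0)
    (CAnd (CExR fork_role shift_concept) (CExR fork_role copy_concept))).

Lemma csem_cell {D} (I : interp D) X x : csem I (cell_concept X) x <->
  i_cn I X x /\ (forall f, In f (crules P M) -> bsem (val I x) f) /\
  (forall y, s_of I x y -> obeys (hrules M) (val I x) (val I y)) /\
  (~ bsem (val I x) (acc_form P) -> exists y, s_of I x y).
Proof.
  unfold cell_concept. cbn [csem]. rewrite !csem_big, csem_imp. cbn [csem].
  rewrite csem_bconcept. setoid_rewrite in_map_iff.
  assert (E : (forall C, (exists p, CImp (bconcept (fst p)) (CAllR s_role (bconcept (snd p))) = C /\
      In p (hrules M)) -> csem I C x) <->
      (forall y, s_of I x y -> obeys (hrules M) (val I x) (val I y))).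
  { split.
    - intros H y Hy f g Hi Hf. specialize (H _ (ex_intro _ (f, g) (conj eq_refl Hi))).
      rewrite csem_imp, csem_allr in H. apply csem_bconcept, H; auto.
      now apply csem_bconcept.
    - intros H C ((f, g) & <- & Hi). rewrite csem_imp, csem_allr. intros Hf y Hy.
      apply csem_bconcept. apply (H y Hy f g Hi). now apply csem_bconcept. }
  rewrite E.
  assert (E' : (forall C, (exists f, bconcept f = C /\ In f (crules P M)) -> csem I C x) <->
      (forall f, In f (crules P M) -> bsem (val I x) f)).
  { split.
    - intros H f Hi. apply csem_bconcept, H. now exists f.
    - intros H C (f & <- & Hi). now apply csem_bconcept, H. }
  rewrite E'.
  assert (E'' : (exists y, s_of I x y /\ True) <-> exists y, s_of I x y) by firstorder.
  rewrite E''. reflexivity.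
Qed.

Lemma csem_chain {D} (I : interp D) X x : csem I (chain_concept X) x <->
  (exists y, s_of I x y) /\ (forall y, s_of I x y -> val I y AH /\ val I y AF) /\
  (forall j y, pow (s_of I) (S j) x y -> csem I (cell_concept X) y).
Proof.
  unfold chain_concept. cbn [csem]. rewrite csem_allr, csem_all_splus.
  setoid_rewrite csem_bconcept. firstorder.
Qed.

(** Only an accepting cell may lack an s-successor, so a path stops before [k] only there. *)
Lemma chain_path {D} (I : interp D) X x k : csem I (chain_concept X) x ->
  exists K f, K <= k /\ (forall j, j <= K -> pow (s_of I) (S j) x (f j)) /\
    (forall j, j < K -> s_of I (f j) (f (S j))) /\
    (K = k \/ bsem (val I (f K)) (acc_form P)).
Proof.
  intros H. apply csem_chain in H as ((y0 & Hy0) & _ & Hcell).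
  induction k as [|k (K & f & HK & Hpow & Hstep & Hend)].
  - exists 0, (fun _ => y0). split; [lia|]. split; [|split; [lia|now left]].
    intros j Hj. replace j with 0 by lia. now apply pow_1.
  - destruct (classic (bsem (val I (f K)) (acc_form P))) as [Ha|Ha].
    + exists K, f. repeat split; auto.
    + destruct Hend as [->|]; [|tauto].
      specialize (Hpow k (le_n k)) as Hk.
      apply Hcell, csem_cell in Hk as (_ & _ & _ & Hs). destruct (Hs Ha) as [z Hz].
      exists (S k), (fun j => if j <=? k then f j else z).
      split; [lia|]. split; [|split; [|now left]].
      * intros j Hj. destruct (Nat.leb_spec j k); [now apply Hpow|].
        replace j with (S k) by lia. eapply pow_snoc; eauto.
      * intros j Hj. destruct (Nat.leb_spec j k); [|lia].
        destruct (Nat.leb_spec (S j) k); [apply Hstep; lia|].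
        replace j with k by lia. exact Hz.
Qed.

End Concept.

(** * From models to accepting runs *)

Definition input_base : concept := bconcept (BAnd (BAtom AF) (BAtom (AR 0))).

Fixpoint input_concept (n : nat) : concept :=
  CExR s_role match n with 0 => input_base | S n => input_concept n end.

Lemma csem_input {D} (I : interp D) n x : csem I (input_concept n) x ->
  exists f : nat -> D, s_of I x (f 0) /\ (forall j, j < n -> s_of I (f j) (f (S j))) /\
    val I (f n) AF /\ val I (f n) (AR 0).
Proof.
  revert x. induction n as [|n IH]; intros x (y & Hy & H).
  - exists (fun _ => y). split; [exact Hy|]. split; [lia|].
    apply csem_bconcept in H. exact H.
  - destruct (IH y H) as (f & Hf0 & Hfs & Hfn).
    exists (fun j => match j with 0 => y | S j => f j end).
    split; [exact Hy|]. split; [|exact Hfn].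
    intros [|j] Hj; [exact Hf0|]. apply Hfs. lia.
Qed.

Lemma pow_path {D} (R : D -> D -> Prop) x (f : nat -> D) n : R x (f 0) ->
  (forall j, j < n -> R (f j) (f (S j))) -> forall j, j <= n -> pow R (S j) x (f j).
Proof.
  intros H0 HS. induction j as [|j IH]; intros Hj; [now apply pow_1|].
  eapply pow_snoc; [apply IH; lia|apply HS; lia].
Qed.

(** The table is read off a path [B] of the second chain, with a path [A] of the first as relay:
    premises pass from [B j] to [A j] on the copying line, and the vertical rules from [A j] to
    [B (j + N)] on the shifted line. *)
Lemma sat_accepts P M n : below P M ->
  satisfiable (CAnd (machine_concept P M) (input_concept n)) -> accepts P n.
Proof.
  intros HP (D & I & a & (Ha & HchA & (et & _ & Hshift) & (ft & _ & Hcopy)) & Hinp).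
  simpl in Ha.
  destruct Hshift as (Hpath & Hlink & HaccB). apply csem_ex_rstar in Hpath.
  destruct Hpath as (k1 & e1 & Htop & (a' & Hea & Ha') & (g & Heg & HM & Hg)).
  simpl in Ha'. subst a'. rewrite <- Ha in Hea.
  apply csem_ex_rstar in Hg as (N & b & Hgb & Hb & HchB). simpl in Hb.
  destruct Hcopy as (Hpath' & Hlink' & HaccA). apply csem_ex_rstar in Hpath'.
  destruct Hpath' as (k2 & f1 & Hftop & (a' & Hfa & Ha') & (b' & Hfb & Hb')).
  simpl in Ha', Hb'. subst a' b'. rewrite <- Ha in Hfa. rewrite <- Hb in Hfb.
  rewrite csem_all_rstar in Hlink, Hlink', HM.
  setoid_rewrite csem_link in Hlink. setoid_rewrite csem_link in Hlink'.
  setoid_rewrite csem_all_rnsn_chain in HM.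
  rewrite csem_all_rnsn_chain in HaccA, HaccB.
  (* The bounds are the last cells seen from the far ends of the two lines: [k1 + N] for the second
     chain on the shifted line, [k2] for the first chain on the copying line. Each far end forces
     acceptance there. *)
  destruct (chain_path P M I 1 b (k1 + N) HchB) as (KB & B & HKB & HBp & HBs & HBend).
  destruct (chain_path P M I 0 a k2 HchA) as (KA & A & HKA & HAp & HAs & HAend).
  apply csem_chain in HchA as (_ & _ & HcA). apply csem_chain in HchB as (_ & HB0 & HcB).
  assert (HAX : forall j x, pow (s_of I) (S j) a x -> i_cn I 0 x).
  { intros j x Hx. apply HcA, csem_cell in Hx. apply Hx. }
  assert (HBX : forall j x, pow (s_of I) (S j) b x -> i_cn I 1 x).
  { intros j x Hx. apply HcB, csem_cell in Hx. apply Hx. }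
  assert (HaccA' : bsem (val I (A KA)) (acc_form P)).
  { destruct HAend as [->|]; auto. apply HaccA; [|eapply HAX; eauto].
    exists (S k2), a. split; [|now apply HAp]. eapply pow_snoc; eauto. }
  assert (HaccB' : bsem (val I (B KB)) (acc_form P)).
  { destruct HBend as [->|]; auto. apply HaccB; [|eapply HBX; eauto].
    exists (S (k1 + N)), b. split; [|now apply HBp].
    rewrite <- Nat.add_succ_r. apply pow_add. exists e1. split; [exact Htop|]. now exists g. }
  (* A node of the copying line at distance [S j] from both nominals. *)
  assert (Hcopy : forall j x y, j <= k2 -> pow (s_of I) (S j) a x -> pow (s_of I) (S j) b y ->
    obeys (copy_rules P M) (val I y) (val I x)).
  { intros j x y Hj Hx Hy. replace k2 with ((k2 - j) + j) in Hftop by lia.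
    apply pow_add in Hftop as (u & Hu & Hu1).
    apply (Hlink' _ u Hu); eauto.
    - exists (S j), b. split; [|exact Hy]. eapply pow_snoc; eauto.
    - exists (S j), a. split; [|exact Hx]. eapply pow_snoc; eauto. }
  assert (Hshift : forall j x y, j <= k1 -> pow (s_of I) (S j) a x ->
    pow (s_of I) (S (j + N)) b y -> obeys (vrules P M) (val I x) (val I y)).
  { intros j x y Hj Hx Hy. replace k1 with ((k1 - j) + j) in Htop by lia.
    apply pow_add in Htop as (u & Hu & Hu1).
    apply (Hlink _ u Hu); eauto.
    - exists (S j), a. split; [|exact Hx]. eapply pow_snoc; eauto.
    - exists (S (j + N)), b. split; [|exact Hy]. rewrite <- Nat.add_succ_r.
      apply pow_add. exists e1. split; [exact Hu1|]. now exists g. }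
  set (K := min KA KB). assert (HK1 : K <= KA) by (unfold K; lia).
  assert (HK2 : K <= KB) by (unfold K; lia).
  (* The rules copy negations from the second chain to the first; contraposition brings the formulas
     themselves from the first to the second. *)
  assert (HcopyF : forall j x f, j <= K -> pow (s_of I) (S j) a x ->
    In f [BAtom AF; BAtom (AR 0); acc_form P] -> bsem (val I x) f -> bsem (val I (B j)) f).
  { intros j x f Hj Hx Hf Hsem. apply NNPP. intros Hn. revert Hsem.
    change (bsem (val I x) (BNot f)).
    apply (Hcopy j x (B j)) with (f := BNot f); [lia|exact Hx|apply HBp; lia| |exact Hn].
    unfold copy_rules. apply in_or_app. right. simpl in Hf |- *.
    destruct Hf as [<-|[<-|[<-|[]]]]; tauto. }
  assert (Hacc : bsem (val I (B K)) (acc_form P)).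
  { destruct (Nat.le_gt_cases KA KB) as [Hle|Hlt].
    - replace K with KA in * by (unfold K; lia).
      apply (HcopyF KA (A KA)); auto. simpl; tauto.
    - replace K with KB by (unfold K; lia). exact HaccB'. }
  assert (HBcell : forall j, j <= K -> csem I (cell_concept P M 1) (B j)).
  { intros j Hj. apply (HcB j). apply HBp. lia. }
  apply csem_input in Hinp as (A' & HA0 & HAs' & HAF & HAR).
  assert (HAp' := pow_path _ _ _ _ HA0 HAs').
  (* The input path [A'] need not be [A]. Its cell [K] is outside the first row because [B K] is
     accepting, and [AF] cannot return later, yet the input cell has it. *)
  assert (HnK : n <= K).
  { destruct (Nat.le_gt_cases n K) as [|Hlt]; [assumption|]. exfalso.
    assert (HnF : forall j, K <= j -> j <= n -> ~ val I (A' j) AF).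
    { induction 1 as [|j Hj IH]; intros Hjn HF.
      - destruct Hacc as [_ Hacc]. apply Hacc.
        apply (HcopyF K (A' K) (BAtom AF)); [lia| |simpl; tauto|exact HF]. apply HAp'. lia.
      - assert (Hc : csem I (cell_concept P M 0) (A' j)) by (apply (HcA j), HAp'; lia).
        apply csem_cell in Hc as (_ & _ & Hh & _).
        specialize (Hh (A' (S j)) ltac:(apply HAs'; lia)). apply hrules_spec in Hh.
        destruct Hh as (Hh & _). apply Hh; [apply IH; lia|exact HF]. }
    exact (HnF n ltac:(lia) (le_n n) HAF). }
  apply (table_accepts P M n N K (fun j => val I (B j)) HP). constructor.
  - apply HB0. apply pow_1. apply HBp. lia.
  - intros j Hj. apply HBcell, csem_cell in Hj. apply Hj.
  - intros j Hj. assert (Hc := HBcell j ltac:(lia)). apply csem_cell in Hc.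
    apply Hc. apply HBs. lia.
  - intros j Hj f h Hi Hf. apply (Hshift j (A j) (B (j + N)) ) with (f := f); auto; try lia.
    + apply HAp. lia.
    + apply HBp. lia.
    + apply (Hcopy j (A j) (B j)) with (f := f); [lia|apply HAp; lia|apply HBp; lia| |exact Hf].
      unfold copy_rules. apply in_or_app. left. apply in_map_iff. now exists (f, h).
  (* On the stretch of [N] steps down to [b], the node at distance [S j] from [b] sees [B j]. *)
  - intros j HjN HjK. assert (HBj : pow (s_of I) (S j) b (B j)) by (apply HBp; lia).
    replace N with ((N - S j) + S j) in Hgb by lia. apply pow_add in Hgb as (u & Hu & Hub).
    apply (HM _ u Hu); [|eapply HBX; eauto]. now exists (S j), b.
  - exact Hacc.
  - split; [exact HnK|]. split.
    + apply (HcopyF n (A' n) (BAtom AF) HnK); [now apply HAp'|simpl; tauto|exact HAF].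
    + apply (HcopyF n (A' n) (BAtom (AR 0)) HnK); [now apply HAp'|simpl; tauto|exact HAR].
Qed.

(** * A model from an accepting table *)

Section Model.
Variables (P : list instr) (M n N K : nat) (v : nat -> valuation).
Hypothesis T : table P M n N K v.

(* [NLine p] is at [r]-distance [p] from the second nominal [NLine 0];
   [NLine (S N)] and [NFork 0] are the [r]-predecessors of the first nominal [NRoot]. *)
Inductive node : Type :=
| NRoot : node
| NLine : nat -> node
| NFork : nat -> node
| NA : nat -> node
| NB : nat -> node.

Inductive r_edge : node -> node -> Prop :=
| re_line p : r_edge (NLine (S p)) (NLine p)
| re_line_root : r_edge (NLine (S N)) NRoot
| re_fork k : r_edge (NFork (S k)) (NFork k)
| re_fork_root : r_edge (NFork 0) NRoot
| re_fork_line : r_edge (NFork 0) (NLine 0).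

Inductive s_edge : node -> node -> Prop :=
| se_root : s_edge NRoot (NA 0)
| se_line : s_edge (NLine 0) (NB 0)
| se_A j : j < K -> s_edge (NA j) (NA (S j))
| se_B j : j < K -> s_edge (NB j) (NB (S j)).

Inductive fork_edge : node -> node -> Prop :=
| fe_line : fork_edge NRoot (NLine (K + S N))
| fe_fork : fork_edge NRoot (NFork K).

Definition node_name (c : nat) (x : node) : Prop :=
  match x with
  | NA j => c = 0 \/ exists a, c = anum a /\ v j a
  | NB j => c = 1 \/ exists a, c = anum a /\ v j a
  | _ => False
  end.

Definition model : interp node := {|
  i_ind := fun i => if i =? 0 then NRoot else NLine 0;
  i_cn := node_name;
  i_rn := fun q => match q with
                   | CallRole 0 => r_edge
                   | RetRole 0 => s_edge
                   | IntRole 0 => fork_edge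
                   | _ => fun _ _ => False
                   end |}.

Lemma val_A j a : val model (NA j) a <-> v j a.
Proof.
  unfold val. simpl. split.
  - intros [H|(b & H & Hb)]; [pose proof (anum_ge a); lia|].
    now apply anum_inj in H as ->.
  - intros H. right. now exists a.
Qed.

Lemma val_B j a : val model (NB j) a <-> v j a.
Proof.
  unfold val. simpl. split.
  - intros [H|(b & H & Hb)]; [pose proof (anum_ge a); lia|].
    now apply anum_inj in H as ->.
  - intros H. right. now exists a.
Qed.

Lemma bsem_ext w w' f : (forall a, w a <-> w' a) -> (bsem w f <-> bsem w' f).
Proof. intros H. induction f; simpl; try rewrite IHf; firstorder. Qed.

Lemma bsem_A j f : bsem (val model (NA j)) f <-> bsem (v j) f.
Proof. apply bsem_ext. apply val_A. Qed.

Lemma bsem_B j f : bsem (val model (NB j)) f <-> bsem (v j) f.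
Proof. apply bsem_ext. apply val_B. Qed.

Lemma name_0 x : node_name 0 x -> exists j, x = NA j.
Proof.
  destruct x; simpl; try tauto; [eauto|].
  intros [H|(a & H & _)]; [lia|]. pose proof (anum_ge a). lia.
Qed.

Lemma name_1 x : node_name 1 x -> exists j, x = NB j.
Proof.
  destruct x; simpl; try tauto; [|eauto].
  intros [H|(a & H & _)]; [lia|]. pose proof (anum_ge a). lia.
Qed.

Lemma pow_s_A i j y : j <= K -> pow s_edge i (NA j) y -> y = NA (j + i) /\ j + i <= K.
Proof.
  revert j. induction i as [|i IH]; intros j Hj; simpl.
  - intros <-. rewrite Nat.add_0_r. auto.
  - intros (z & Hz & H). inversion Hz; subst. apply IH in H; [|lia].
    now rewrite <- Nat.add_succ_comm.
Qed.

Lemma pow_s_B i j y : j <= K -> pow s_edge i (NB j) y -> y = NB (j + i) /\ j + i <= K.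
Proof.
  revert j. induction i as [|i IH]; intros j Hj; simpl.
  - intros <-. rewrite Nat.add_0_r. auto.
  - intros (z & Hz & H). inversion Hz; subst. apply IH in H; [|lia].
    now rewrite <- Nat.add_succ_comm.
Qed.

Lemma pow_s_root i y : pow s_edge i NRoot y ->
  (i = 0 /\ y = NRoot) \/ exists j, i = S j /\ y = NA j /\ j <= K.
Proof.
  destruct i as [|i]; simpl; [intros <-; auto|].
  intros (z & Hz & H). inversion Hz; subst. apply pow_s_A in H as [-> H]; [|lia].
  right. now exists i.
Qed.

Lemma pow_s_line i p y : pow s_edge i (NLine p) y ->
  (i = 0 /\ y = NLine p) \/ exists j, p = 0 /\ i = S j /\ y = NB j /\ j <= K.
Proof.
  destruct i as [|i]; simpl; [intros <-; auto|].
  intros (z & Hz & H). inversion Hz; subst. apply pow_s_B in H as [-> H]; [|lia].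
  right. now exists i.
Qed.

Lemma pow_s_fork i k y : pow s_edge i (NFork k) y -> y = NFork k.
Proof.
  destruct i as [|i]; simpl; [now intros <-|].
  intros (z & Hz & H). inversion Hz.
Qed.

Lemma pow_r_root i y : pow r_edge i NRoot y -> i = 0 /\ y = NRoot.
Proof.
  destruct i as [|i]; simpl; [now intros <-|].
  intros (z & Hz & H). inversion Hz.
Qed.

(** The distances from [NLine p] to the two nominals differ by exactly [N]: they are [p] and, if [p]
    exceeds [N], [p - N]. *)
Lemma pow_r_line i p y : pow r_edge i (NLine p) y ->
  (i <= p /\ y = NLine (p - i)) \/ (p = i + N /\ 0 < i /\ y = NRoot).
Proof.
  revert p. induction i as [|i IH]; intros p; simpl.
  - intros <-. left. rewrite Nat.sub_0_r. split; [lia|reflexivity].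
  - intros (z & Hz & H). inversion Hz; subst.
    + apply IH in H as [[Hi ->]|(-> & Hi & ->)]; [left|right].
      * split; [lia|reflexivity].
      * repeat split; lia.
    + apply pow_r_root in H as [-> ->]. right. repeat split; lia.
Qed.

Lemma pow_r_fork i k y : pow r_edge i (NFork k) y ->
  (i <= k /\ y = NFork (k - i)) \/ (i = S k /\ (y = NRoot \/ y = NLine 0)).
Proof.
  revert k. induction i as [|i IH]; intros k; simpl.
  - intros <-. left. rewrite Nat.sub_0_r. split; [lia|reflexivity].
  - intros (z & Hz & H). inversion Hz; subst.
    + apply IH in H as [[Hi ->]|(-> & Hy)]; [left|right].
      * split; [lia|reflexivity].
      * split; [lia|exact Hy].
    + apply pow_r_root in H as [-> ->]. right. auto.
    + apply pow_r_line in H as [[Hi ->]|(Hc & Hi & ->)]; [|lia].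
      right. split; [lia|]. right. reflexivity.
Qed.

Lemma sees_line_A p j : sees model (NLine p) (NA j) -> j <= K /\ p = S j + N.
Proof.
  intros (i & m & H1 & H2). simpl in H1, H2.
  apply pow_r_line in H1 as [[Hi ->]|(-> & Hi & ->)].
  - apply pow_s_line in H2 as [[_ H]|(j' & _ & _ & H & _)]; discriminate.
  - apply pow_s_root in H2 as [[_ H]|(j' & -> & H & Hj)]; [discriminate|].
    inversion H; subst. split; [exact Hj|reflexivity].
Qed.

Lemma sees_line_B p j : sees model (NLine p) (NB j) -> j <= K /\ p = S j.
Proof.
  intros (i & m & H1 & H2). simpl in H1, H2.
  apply pow_r_line in H1 as [[Hi ->]|(-> & Hi & ->)].
  - apply pow_s_line in H2 as [[_ H]|(j' & Hp & -> & H & Hj)]; [discriminate|].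
    inversion H; subst. split; [exact Hj|lia].
  - apply pow_s_root in H2 as [[_ H]|(j' & -> & H & Hj)]; discriminate.
Qed.

Lemma sees_fork_A k j : sees model (NFork k) (NA j) -> j <= K /\ k = j.
Proof.
  intros (i & m & H1 & H2). simpl in H1, H2.
  apply pow_r_fork in H1 as [[Hi ->]|(-> & [->| ->])].
  - apply pow_s_fork in H2. discriminate.
  - apply pow_s_root in H2 as [[_ H]|(j' & Hp & H & Hj)]; [discriminate|].
    inversion H; subst. split; [exact Hj|lia].
  - apply pow_s_line in H2 as [[_ H]|(j' & _ & _ & H & Hj)]; discriminate.
Qed.

Lemma sees_fork_B k j : sees model (NFork k) (NB j) -> j <= K /\ k = j.
Proof.
  intros (i & m & H1 & H2). simpl in H1, H2.
  apply pow_r_fork in H1 as [[Hi ->]|(-> & [->| ->])].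
  - apply pow_s_fork in H2. discriminate.
  - apply pow_s_root in H2 as [[_ H]|(j' & _ & H & Hj)]; discriminate.
  - apply pow_s_line in H2 as [[_ H]|(j' & _ & Hp & H & Hj)]; [discriminate|].
    inversion H; subst. split; [exact Hj|lia].
Qed.

Lemma sees_root_line_AB x : sees model NRoot x -> x = NRoot \/ exists j, x = NA j.
Proof.
  intros (i & m & H1 & H2). simpl in H1, H2. apply pow_r_root in H1 as [-> ->].
  simpl in H2. auto.
Qed.

Lemma acc_stop j : j <= K -> ~ bsem (v j) (acc_form P) -> j < K.
Proof.
  intros Hj Ha. destruct (Nat.eq_dec j K) as [->|]; [|lia].
  exfalso. apply Ha, (table_acc _ _ _ _ _ _ T).
Qed.

Lemma cell_A j : j <= K -> csem model (cell_concept P M 0) (NA j).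
Proof.
  intros Hj. apply csem_cell. split; [simpl; auto|]. split; [|split].
  - intros f Hf. apply bsem_A. now apply (table_cell _ _ _ _ _ _ T).
  - intros y Hy f g Hi. simpl in Hy. inversion Hy as [| |? Hlt|]; subst.
    rewrite !bsem_A. now apply (table_h _ _ _ _ _ _ T).
  - rewrite bsem_A. intros Ha. exists (NA (S j)). simpl. constructor. now apply acc_stop.
Qed.

Lemma cell_B j : j <= K -> csem model (cell_concept P M 1) (NB j).
Proof.
  intros Hj. apply csem_cell. split; [simpl; auto|]. split; [|split].
  - intros f Hf. apply bsem_B. now apply (table_cell _ _ _ _ _ _ T).
  - intros y Hy f g Hi. simpl in Hy. inversion Hy as [| | |? Hlt]; subst.
    rewrite !bsem_B. now apply (table_h _ _ _ _ _ _ T).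
  - rewrite bsem_B. intros Ha. exists (NB (S j)). simpl. constructor. now apply acc_stop.
Qed.

Lemma chain_A : csem model (chain_concept P M 0) NRoot.
Proof.
  apply csem_chain. split; [|split].
  - exists (NA 0). constructor.
  - intros y Hy. simpl in Hy. inversion Hy; subst. rewrite !val_A.
    apply (table_start _ _ _ _ _ _ T).
  - intros j y Hy. simpl in Hy. apply (pow_s_root (S j)) in Hy as [[H _]|(j' & _ & -> & Hj)];
      [lia|now apply cell_A].
Qed.

Lemma chain_B : csem model (chain_concept P M 1) (NLine 0).
Proof.
  apply csem_chain. split; [|split].
  - exists (NB 0). constructor.
  - intros y Hy. simpl in Hy. inversion Hy; subst. rewrite !val_B.
    apply (table_start _ _ _ _ _ _ T).
  - intros j y Hy. simpl in Hy.
    apply (pow_s_line (S j)) in Hy as [[H _]|(j' & _ & _ & -> & Hj)];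
      [lia|now apply cell_B].
Qed.

Lemma pow_line i p : pow r_edge i (NLine (i + p)) (NLine p).
Proof.
  induction i as [|i IH]; simpl; [reflexivity|].
  exists (NLine (i + p)). split; [constructor|exact IH].
Qed.

Lemma pow_fork i k : pow r_edge i (NFork (i + k)) (NFork k).
Proof.
  induction i as [|i IH]; simpl; [reflexivity|].
  exists (NFork (i + k)). split; [constructor|exact IH].
Qed.

(** There are [K] steps from the far end to the branching node [NLine (S N)], enough to compare all
    vertical neighbours. The far end would see cell [K + N] of the second chain, which is absent
    because [N] is positive, so its acceptance condition is vacuous. *)
Lemma shift_sem : csem model (shift_concept P M) (NLine (K + S N)).
Proof.
  unfold shift_concept. rewrite !csem_and. split; [|split].
  - apply csem_ex_rstar. exists K, (NLine (S N)). split; [apply pow_line|].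
    rewrite csem_and, !csem_exr. split.
    + exists NRoot. split; [constructor|reflexivity].
    + exists (NLine N). split; [constructor|]. apply csem_and. split.
      * apply csem_all_rstar. intros i e He. simpl in He. apply csem_all_rnsn_chain.
        intros y Hy Hn. apply name_1 in Hn as [j ->].
        apply pow_r_line in He as [[Hi ->]|(Hc & Hi & ->)]; [|lia].
        apply sees_line_B in Hy as [Hj Hp].
        apply bsem_B. apply (table_first _ _ _ _ _ _ T); lia.
      * apply csem_ex_rstar. exists N, (NLine 0). rewrite csem_and. split; [|split].
        -- rewrite <- (Nat.add_0_r N) at 2. apply pow_line.
        -- reflexivity.
        -- apply chain_B.
  - apply csem_all_rstar. intros i e He. simpl in He. apply csem_link.
    intros x y Hx Hy H0 H1. apply name_0 in H0 as [j ->]. apply name_1 in H1 as [k ->].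
    apply pow_r_line in He as [[Hi ->]|(Hc & Hi & ->)].
    + apply sees_line_A in Hx as [Hj Hp]. apply sees_line_B in Hy as [Hk Hp'].
      replace k with (j + N) in * by lia. intros f g Hf. rewrite bsem_A, bsem_B.
      now apply (table_v _ _ _ _ _ _ T).
    + apply sees_root_line_AB in Hy as [Hy|[k' Hy]]; discriminate.
  - apply csem_all_rnsn_chain. intros y Hy H1. apply name_1 in H1 as [k ->].
    apply sees_line_B in Hy. pose proof (table_width _ _ _ _ _ _ T). lia.
Qed.

Lemma copy_sem : csem model (copy_concept P M) (NFork K).
Proof.
  unfold copy_concept. rewrite !csem_and. split; [|split].
  - apply csem_ex_rstar. exists K, (NFork 0). rewrite csem_and, !csem_exr. split; [|split].
    + rewrite <- (Nat.add_0_r K) at 2. apply pow_fork.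
    + exists NRoot. split; [constructor|reflexivity].
    + exists (NLine 0). split; [constructor|reflexivity].
  - apply csem_all_rstar. intros i e He. simpl in He. apply csem_link.
    intros x y Hx Hy H1 H0. apply name_0 in H0 as [j ->]. apply name_1 in H1 as [k ->].
    apply pow_r_fork in He as [[Hi ->]|(_ & [->| ->])].
    + apply sees_fork_A in Hy as [Hj Hp]. apply sees_fork_B in Hx as [Hk Hp'].
      replace k with j in * by lia. intros f g Hf. rewrite bsem_A, bsem_B.
      unfold copy_rules in Hf. apply in_app_or in Hf as [Hf|Hf].
      (* Both chains carry the same table [v], so copying a formula between equal indices is
         trivial. *)
      * apply in_map_iff in Hf as (q & Hq & _). inversion Hq. tauto.
      * simpl in Hf.
        destruct Hf as [Hq|[Hq|[Hq|[]]]]; inversion Hq; tauto.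
    + apply sees_root_line_AB in Hx as [Hx|[k' Hx]]; discriminate.
    + apply sees_line_A in Hy as [_ Hy]. lia.
  - apply csem_all_rnsn_chain. intros y Hy H0. apply name_0 in H0 as [j ->].
    apply sees_fork_A in Hy as [_ <-]. apply bsem_A, (table_acc _ _ _ _ _ _ T).
Qed.

Lemma input_sem : csem model (input_concept n) NRoot.
Proof.
  destruct (table_input _ _ _ _ _ _ T) as (Hn & HF & HR).
  assert (Hbase : csem model input_base (NA n)).
  { apply csem_bconcept. apply bsem_A. split; assumption. }
  assert (H : forall m j, j + m = n -> csem model
    (match m with 0 => input_base | S m => input_concept m end) (NA j)).
  { induction m as [|m IH]; intros j Hj.
    - replace j with n by lia. exact Hbase.
    - assert (Hs : s_edge (NA j) (NA (S j))) by (constructor; lia).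
      assert (Hrec := IH (S j) ltac:(lia)).
      destruct m; exists (NA (S j)); (split; [exact Hs|exact Hrec]). }
  specialize (H n 0 eq_refl). destruct n; exists (NA 0); (split; [constructor|exact H]).
Qed.

Lemma table_satisfiable : satisfiable (CAnd (machine_concept P M) (input_concept n)).
Proof.
  exists node, model, NRoot. split; [|apply input_sem].
  split; [reflexivity|]. split; [apply chain_A|]. split.
  - exists (NLine (K + S N)). split; [constructor|apply shift_sem].
  - exists (NFork K). split; [constructor|apply copy_sem].
Qed.

End Model.

Lemma accepts_sat P M n : below P M -> P <> [] -> accepts P n ->
  satisfiable (CAnd (machine_concept P M) (input_concept n)).
Proof.
  intros HP HP0 H. destruct (accepts_table P M n HP HP0 H) as (N & K & _ & T).
  eapply table_satisfiable, T.
Qed.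

(** * Codes and the diagonal argument *)

Fixpoint tri (n : nat) : nat := match n with 0 => 0 | S m => S m + tri m end.

Lemma tri_double n : 2 * tri n = n * (n + 1).
Proof. induction n as [|n IH]; [reflexivity|]. cbn [tri]. lia. Qed.

Lemma cpair_tri x y : cpair x y = tri (x + y) + y.
Proof.
  unfold cpair. rewrite <- tri_double, Nat.mul_comm, Nat.div_mul by lia. reflexivity.
Qed.

(** Pairs with sum [m] have codes from [tri m] to [tri m + m], all below the codes of any larger
    sum. *)
Lemma tri_lt m n : m < n -> tri m + m < tri n.
Proof. induction 1 as [|n H IH]; cbn [tri]; lia. Qed.

Lemma cpair_inj x y x' y' : cpair x y = cpair x' y' -> x = x' /\ y = y'.
Proof.
  rewrite !cpair_tri. intros H.
  destruct (Nat.lt_trichotomy (x + y) (x' + y')) as [Hlt|[He|Hlt]].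
  - apply tri_lt in Hlt. lia.
  - rewrite He in H. lia.
  - apply tri_lt in Hlt. lia.
Qed.

Lemma enc_role_inj q q' : enc_role q = enc_role q' -> q = q'.
Proof. destruct q, q'; cbn [enc_role]; intros H; try (exfalso; lia); f_equal; lia. Qed.

Lemma enc_lang_inj L L' : enc_lang L = enc_lang L' -> L = L'.
Proof. destruct L, L'; intros H; try reflexivity; discriminate. Qed.

Lemma enc_concept_inj C C' : enc_concept C = enc_concept C' -> C = C'.
Proof.
  revert C'. induction C as [|A|a|C IH|C1 IH1 C2 IH2|q C IH|L C IH]; intros [|A'|a'|D|D1 D2|q' D|L' D];
    cbn [enc_concept]; intros H; apply cpair_inj in H as [Ht H]; try discriminate;
    f_equal; auto; apply cpair_inj in H as [H1 H2]; auto using enc_role_inj, enc_lang_inj.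
Qed.

(** * Recursive functions on codes of concepts *)

Definition rf_add : rf := RPrim (RProj 0) (RComp RSucc [RProj 1]).
Definition rf_tri : rf :=
  RPrim RZero (RComp rf_add [RComp RSucc [RProj 0]; RProj 1]).
Definition rf_cpair : rf :=
  RComp rf_add [RComp rf_tri [RComp rf_add [RProj 0; RProj 1]]; RProj 1].
Fixpoint rf_const (k : nat) : rf :=
  match k with 0 => RZero | S k => RComp RSucc [rf_const k] end.
Definition rf_is_zero : rf := RPrim (rf_const 1) RZero.

Lemma eval_comp1 f g v x y : eval g v x -> eval f [x] y -> eval (RComp f [g]) v y.
Proof. intros H H'. eapply ev_comp; [|exact H']. repeat constructor. exact H. Qed.

Lemma eval_comp2 f g h v x x' y : eval g v x -> eval h v x' -> eval f [x; x'] y ->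
  eval (RComp f [g; h]) v y.
Proof. intros H H' H''. eapply ev_comp; [|exact H'']. repeat constructor; assumption. Qed.

Lemma eval_proj i v x : nth i v 0 = x -> eval (RProj i) v x.
Proof. intros <-. constructor. Qed.

Lemma eval_const k v : eval (rf_const k) v k.
Proof.
  induction k as [|k IH]; [constructor|]. eapply eval_comp1; [exact IH|constructor].
Qed.

Lemma eval_add m n : eval rf_add [m; n] (m + n).
Proof.
  induction m as [|m IH]; [apply ev_prim0; now apply eval_proj|].
  eapply ev_primS; [exact IH|]. eapply eval_comp1; [now apply eval_proj|constructor].
Qed.

Lemma eval_tri n : eval rf_tri [n] (tri n).
Proof.
  induction n as [|n IH]; [apply ev_prim0; constructor|].
  eapply ev_primS; [exact IH|].
  eapply eval_comp2; [|now apply eval_proj|apply eval_add].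
  eapply eval_comp1; [now apply eval_proj|constructor].
Qed.

Lemma eval_cpair x y : eval rf_cpair [x; y] (cpair x y).
Proof.
  rewrite cpair_tri. eapply eval_comp2; [|now apply eval_proj|apply eval_add].
  eapply eval_comp1; [|apply eval_tri].
  eapply eval_comp2; [now apply eval_proj|now apply eval_proj|apply eval_add].
Qed.

Lemma eval_cpair_comp f g v x y : eval f v x -> eval g v y ->
  eval (RComp rf_cpair [f; g]) v (cpair x y).
Proof. intros H H'. eapply eval_comp2; eauto using eval_cpair. Qed.

Lemma eval_is_zero n : eval rf_is_zero [n] (if n =? 0 then 1 else 0).
Proof.
  induction n as [|n IH]; [apply ev_prim0, eval_const|].
  eapply ev_primS; [exact IH|constructor].
Qed.

(** Each round of the recursion wraps the code obtained so far, [RProj 1], in one more existential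
    restriction on s; 5 is the tag of [CExR]. *)
Definition rf_input : rf :=
  RPrim (rf_const (enc_concept (input_concept 0)))
        (RComp rf_cpair [rf_const 5; RComp rf_cpair [rf_const (enc_role s_role); RProj 1]]).

Lemma eval_input n : eval rf_input [n] (enc_concept (input_concept n)).
Proof.
  induction n as [|n IH]; [apply ev_prim0, eval_const|].
  eapply ev_primS; [exact IH|].
  apply eval_cpair_comp; [apply eval_const|].
  apply eval_cpair_comp; [apply eval_const|]. now apply eval_proj.
Qed.

(* On input [enc_concept C] this computes the negation of the answer of [c] on [C]
   conjoined with the input concept of the number [enc_concept C] itself. *)
Definition rf_diagonal (c : rf) : rf :=
  RComp rf_is_zero [RComp c [RComp rf_cpair [rf_const 4; RComp rf_cpair [RProj 0; rf_input]]]].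

Lemma eval_diagonal c C y :
  eval c [enc_concept (CAnd C (input_concept (enc_concept C)))] y ->
  eval (rf_diagonal c) [enc_concept C] (if y =? 0 then 1 else 0).
Proof.
  intros H. eapply eval_comp1; [|apply eval_is_zero].
  eapply eval_comp1; [|exact H]. cbn [enc_concept].
  apply eval_cpair_comp; [apply eval_const|].
  apply eval_cpair_comp; [now apply eval_proj|apply eval_input].
Qed.

Lemma SAT_set_enc C : SAT_set (enc_concept C) <-> satisfiable C.
Proof.
  split; [|intros H; now exists C].
  intros (C' & HC & H). now apply enc_concept_inj in HC as <-.
Qed.

Theorem theorem4p15 : ~ rf_decidable SAT_set.
Proof.
  intros [c Hc].
  set (P := machine (rf_diagonal c)). destruct (below_exists P) as [M HP].
  assert (HP0 : P <> []).
  { unfold P, machine. intros H. now apply app_eq_nil in H as [_ H]. }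
  set (C := machine_concept P M).
  (* [P] depends only on [c], and [C] only on [P] and its bound [M], so the code of [C] may serve as
     input without circularity. *)
  set (n := enc_concept C). set (C' := CAnd C (input_concept n)).
  destruct (Hc (enc_concept C')) as [Hyes Hno]. rewrite SAT_set_enc in Hyes, Hno.
  assert (Hsat : satisfiable C' <-> accepts P n).
  { split; [now apply sat_accepts|now apply accepts_sat]. }
  (* In either case [P] reverses the answer of [c] on [C'], while satisfiability of [C'] means that
     [P] accepts [n]. *)
  destruct (classic (satisfiable C')) as [Hs|Hs].
  - assert (H := eval_diagonal c C 1 (Hyes Hs)).
    apply machine_accepts in H. now apply Hsat, H in Hs.
  - assert (H := eval_diagonal c C 0 (Hno Hs)).
    apply machine_accepts in H. apply Hs, Hsat, H. discriminate.
Qed.
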